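(* Let $f:\mathbb{T}\to\mathbb{C}$ be continuous with Fourier series $$f\sim\sum_{k=0}^\infty A_k(x),\qquad A_k(x)=d_k\cos(kx+\phi_k),$$ where $d_k\in\mathbb{C}$, $\phi_k\in\mathbb{R}$ and $A_0=d_0$. Suppose that the sequence $(|d_k|)_{k\ge1}$ is nonincreasing. Then there is a permutation (bijection) $\sigma:\mathbb{N}\to\mathbb{N}$ such that $$\left\|f-d_0-\sum_{k=1}^n A_{\sigma(k)}\right\|\to0\quad(n\to\infty).$$
   Context: $\mathbb{T}=\mathbb{R}/2\pi\mathbb{Z}$ and $\mathbb{N}=\{1,2,3,\dots\}$. For a continuous function $g:\mathbb{T}\to\mathbb{C}$, $\|g\|=\max_{x\in\mathbb{T}}|g(x)|$ is the uniform norm. If $c_k=\frac1{2\pi}\int_0^{2\pi}f(x)e^{-ikx}\,dx$ ($k\in\mathbb{Z}$) are the Fourier coefficients of $f$, the notation $f\sim\sum_{k=0}^\infty A_k(x)$ means that $A_0=c_0$ and $A_k(x)=c_ke^{ikx}+c_{-k}e^{-ikx}$ for $k\ge1$. *)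

(* Defs.v *)
From Stdlib Require Import Reals ZArith Lra Lia.
From Coquelicot Require Import Coquelicot.

Open Scope R_scope.

(* A continuous map T -> C, where T = R / 2 pi Z, is represented by its
   continuous 2 pi-periodic lift to R. *)
Definition continuous_on_circle (g : R -> C) : Prop :=
  (forall x : R, continuous g x) /\ (forall x : R, g (x + 2 * PI) = g x).

(* e^{i t} *)
Definition Cexp_i (t : R) : C := (cos t, sin t).

Definition fourier_coeff (f : R -> C) (k : Z) : C :=
  (RtoC (/ (2 * PI)) *
   RInt (V := C_R_CompleteNormedModule)
     (fun x : R => f x * Cexp_i (- (IZR k * x)))%C 0 (2 * PI))%C.

Definition fourier_term (f : R -> C) (k : nat) (x : R) : C :=
  match k with
  | O => fourier_coeff f 0
  | S _ =>
      (fourier_coeff f (Z.of_nat k) * Cexp_i (INR k * x) +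
       fourier_coeff f (- Z.of_nat k) * Cexp_i (- (INR k * x)))%C
  end.

(* The supremum of |g|; [real] sends an infinite supremum to 0, which cannot
   occur for a continuous periodic g, by [unif_norm_is_max] below. *)
Definition unif_norm (g : R -> C) : R :=
  real (Lub_Rbar (fun y : R => exists x : R, y = Cmod (g x))).

(* Bijections of {1, 2, 3, ...}; the value of sigma at 0 is irrelevant. *)
Definition permutation_pos (sigma : nat -> nat) : Prop :=
  (forall k : nat, (1 <= k)%nat -> (1 <= sigma k)%nat) /\
  (forall j k : nat, (1 <= j)%nat -> (1 <= k)%nat ->
     sigma j = sigma k -> j = k) /\
  (forall m : nat, (1 <= m)%nat ->
     exists k : nat, (1 <= k)%nat /\ sigma k = m).

Lemma periodic_Z (g : R -> C) :
  (forall x : R, g (x + 2 * PI) = g x) ->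
  forall (k : Z) (x : R), g (x + IZR k * (2 * PI)) = g x.
Proof.
  intros Hp.
  assert (Hn : forall (n : nat) (x : R), g (x + INR n * (2 * PI)) = g x).
  { induction n as [|n IH]; intros x.
    - simpl. f_equal. ring.
    - rewrite S_INR.
      replace (x + (INR n + 1) * (2 * PI))
        with ((x + INR n * (2 * PI)) + 2 * PI) by ring.
      rewrite Hp. apply IH. }
  intros k x. destruct (Z_le_gt_dec 0 k) as [Hk|Hk].
  - rewrite <- (Z2Nat.id k Hk), <- INR_IZR_INZ. apply Hn.
  - rewrite <- (Hn (Z.to_nat (- k)) (x + IZR k * (2 * PI))).
    rewrite INR_IZR_INZ, Z2Nat.id, opp_IZR by lia.
    f_equal. ring.
Qed.

Lemma unif_norm_is_max (g : R -> C) :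
  continuous_on_circle g ->
  (exists x : R, Cmod (g x) = unif_norm g) /\
  (forall x : R, Cmod (g x) <= unif_norm g).
Proof.
  intros [Hc Hp].
  pose proof PI_RGT_0 as Hpi.
  assert (Hcont : forall x, continuity_pt (fun t => Cmod (g t)) x).
  { intros x. apply continuity_pt_filterlim.
    assert (H1 : continuous (fun t => fst (g t)) x)
      by (apply (continuous_comp g fst); [apply Hc | apply continuous_fst]).
    assert (H2 : continuous (fun t => snd (g t)) x)
      by (apply (continuous_comp g snd); [apply Hc | apply continuous_snd]).
    unfold Cmod.
    apply (continuous_comp (fun t => fst (g t) ^ 2 + snd (g t) ^ 2) sqrt).
    - apply (continuous_plus (fun t => fst (g t) ^ 2) (fun t => snd (g t) ^ 2));
      simpl.
      + apply (continuous_mult (fun t => fst (g t)) (fun t => fst (g t) * 1));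
          [exact H1 |].
        apply (continuous_mult (fun t => fst (g t)) (fun _ => 1));
          [exact H1 | apply continuous_const].
      + apply (continuous_mult (fun t => snd (g t)) (fun t => snd (g t) * 1));
          [exact H2 |].
        apply (continuous_mult (fun t => snd (g t)) (fun _ => 1));
          [exact H2 | apply continuous_const].
    - apply continuous_sqrt. }
  destruct (continuity_ab_maj (fun t => Cmod (g t)) 0 (2 * PI)) as [M [HM _]];
    [lra | intros; apply Hcont |].
  assert (HM' : forall x, Cmod (g x) <= Cmod (g M)).
  { intros x. set (k := Int_part (x / (2 * PI))).
    rewrite <- (periodic_Z g Hp (- k) x).
    apply HM. rewrite opp_IZR.
    destruct (base_Int_part (x / (2 * PI))) as [Ha Hb]. fold k in Ha, Hb.
    replace x with (x / (2 * PI) * (2 * PI)) at 1 2 by (field; lra).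
    split; nra. }
  assert (Heq : unif_norm g = Cmod (g M)).
  { unfold unif_norm.
    rewrite (is_lub_Rbar_unique _ (Finite (Cmod (g M)))); [reflexivity |].
    split.
    - intros y [x ->]. simpl. apply HM'.
    - intros b Hb. apply Hb. now exists M. }
  rewrite Heq. split; [now exists M | exact HM'].
Qed.

(* Main.v *)
Require Import Defs.
From Stdlib Require Import Reals.
From Coquelicot Require Import Coquelicot.
From Stdlib Require Import Lra Lia List Permutation Psatz ClassicalEpsilon.
Import ListNotations.
Open Scope R_scope.

(** A continuous function is the uniform limit of its de la Vallee Poussin means
[V_L], which keep the frequencies up to [L] and damp those in [(L, 2L]] by
weights between 0 and 1.  Put [delta_L = |d_L| + 1/L].  The coefficients are
square summable and their moduli are nonincreasing, so [L |d_L|^2] tends to 0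
and with it [sqrt L * delta_L].  An error of order [sqrt L * delta_L] is
therefore negligible, whereas the extra factor [sqrt (log L)] of a random choice
would not be.  Two constructions stay within such an error.

Rounding ([block_rounding]).  The weights of [V_L] on [(L, 2L]] can be replaced
by weights 0 and 1.  With [L = 2^m] this gives a finite set of frequencies
[T_m], containing [1, ..., 2^m] and contained in [1, ..., 2^(m+1)], whose
partial sum is uniformly close to [f].

Ordering ([block_ordering]).  The terms of [T_(m+1)] outside [T_m] have a small
sum, and they can be ordered so that all the partial sums stay small.

Listing the ordered differences one after the other gives the permutation
([uniform_rearrangement]).

Both constructions rest on discrepancy theory in the manner of Spencer's six
standard deviations theorem.  A trigonometric polynomial of degree [n] is
controlled by its values at [4n] points ([grid_sup_bound]), so one has to handle
[N = O(L)] linear forms, with coefficients in [[-1, 1]] after division by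
[delta_L], in [a = O(L)] variables.  [full_coloring] rounds any point of the cube
to a vertex with error [O((N a)^(1/4))] in every form; for [a] and [N] of order
[L] this is [O(sqrt L)], and it decreases geometrically when [a] is halved.  Hence
a set can be halved again and again, and reading the leaves of the resulting
binary tree from left to right gives an ordering all of whose partial sums are
bounded by a geometric series of errors ([balanced_ordering]).

The rounding is a deterministic walk inside the cube ([walk_step]).  Each step is
orthogonal to the position, to the gradient of a quartic potential and to the
forms that have already moved far, and it fixes the coordinates that have reached
the boundary.  Among the directions left, an averaging argument ([kernel_frame],
[good_direction]) finds one along which the potential hardly grows.  The potential
stays of order [N], so only a small proportion of the [a] dimensions is ever lost
to forms that moved far, and the walk goes on until half of the coordinates have
reached the boundary. *)

(** * Sums over lists *)

Fixpoint lsum {A : Type} (l : list A) (f : A -> R) : R :=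
  match l with
  | nil => 0
  | a :: l' => f a + lsum l' f
  end.

Lemma lsum_ext {A} (l : list A) f g :
  (forall a, In a l -> f a = g a) -> lsum l f = lsum l g.
Proof.
  induction l as [|a l IH]; simpl; intros H; [reflexivity|].
  rewrite (H a), IH; auto.
Qed.

Lemma lsum_plus {A} (l : list A) f g :
  lsum l (fun a => f a + g a) = lsum l f + lsum l g.
Proof. induction l as [|a l IH]; simpl; lra. Qed.

Lemma lsum_minus {A} (l : list A) f g :
  lsum l (fun a => f a - g a) = lsum l f - lsum l g.
Proof. induction l as [|a l IH]; simpl; lra. Qed.

Lemma lsum_scal {A} (l : list A) c f :
  lsum l (fun a => c * f a) = c * lsum l f.
Proof. induction l as [|a l IH]; simpl; [ring|rewrite IH; ring]. Qed.

Lemma lsum_le {A} (l : list A) f g :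
  (forall a, In a l -> f a <= g a) -> lsum l f <= lsum l g.
Proof.
  induction l as [|a l IH]; simpl; intros H; [lra|].
  apply Rplus_le_compat; auto.
Qed.

Lemma lsum_lt {A} (l : list A) f g b :
  (forall a, In a l -> f a <= g a) -> In b l -> f b < g b ->
  lsum l f < lsum l g.
Proof.
  induction l as [|a l IH]; simpl; intros H Hb Hlt; [easy|].
  destruct Hb as [->|Hb].
  - apply Rplus_lt_le_compat; [exact Hlt|]. apply lsum_le; auto.
  - apply Rplus_le_lt_compat; auto.
Qed.

Lemma lsum_const {A} (l : list A) c : lsum l (fun _ => c) = INR (length l) * c.
Proof.
  induction l as [|a l IH]; simpl length; [simpl; ring|].
  rewrite S_INR. simpl. rewrite IH. ring.
Qed.

Lemma lsum_0 {A} (l : list A) f : (forall a, In a l -> f a = 0) -> lsum l f = 0.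
Proof.
  intros H. rewrite (lsum_ext l f (fun _ => 0)) by exact H.
  rewrite lsum_const. ring.
Qed.

Lemma lsum_nonneg {A} (l : list A) f : (forall a, In a l -> 0 <= f a) -> 0 <= lsum l f.
Proof.
  intros H. rewrite <- (lsum_0 l (fun _ => 0)) by reflexivity. now apply lsum_le.
Qed.

Lemma lsum_abs {A} (l : list A) f : Rabs (lsum l f) <= lsum l (fun a => Rabs (f a)).
Proof.
  induction l as [|a l IH]; simpl; [rewrite Rabs_R0; lra|].
  eapply Rle_trans; [apply Rabs_triang|lra].
Qed.

Lemma lsum_abs_le {A} (l : list A) f c :
  (forall a, In a l -> Rabs (f a) <= c) -> Rabs (lsum l f) <= INR (length l) * c.
Proof.
  intros H. eapply Rle_trans; [apply lsum_abs|].
  rewrite <- lsum_const. now apply lsum_le.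
Qed.

Lemma lsum_app {A} (l l' : list A) f : lsum (l ++ l') f = lsum l f + lsum l' f.
Proof. induction l as [|a l IH]; simpl; lra. Qed.

Lemma lsum_map {A B} (h : A -> B) (l : list A) f :
  lsum (map h l) f = lsum l (fun a => f (h a)).
Proof. induction l as [|a l IH]; simpl; [reflexivity|now rewrite IH]. Qed.

Lemma lsum_swap {A B} (l : list A) (l' : list B) f :
  lsum l (fun a => lsum l' (f a)) = lsum l' (fun b => lsum l (fun a => f a b)).
Proof.
  induction l as [|a l IH]; simpl.
  - symmetry. now apply lsum_0.
  - rewrite IH, <- lsum_plus. reflexivity.
Qed.

Lemma lsum_filter {A} (p : A -> bool) (l : list A) f :
  lsum (filter p l) f = lsum l (fun a => if p a then f a else 0).
Proof.
  induction l as [|a l IH]; simpl; [reflexivity|].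
  destruct (p a); simpl; rewrite IH; ring.
Qed.

Lemma lsum_filter_split {A} (p : A -> bool) (l : list A) f :
  lsum l f = lsum (filter p l) f + lsum (filter (fun a => negb (p a)) l) f.
Proof.
  rewrite !lsum_filter, <- lsum_plus. apply lsum_ext; intros a _.
  destruct (p a); simpl; ring.
Qed.

Lemma lsum_perm {A} (l l' : list A) f : Permutation l l' -> lsum l f = lsum l' f.
Proof. induction 1; simpl; lra. Qed.

Definition dot (A : list nat) (v u : nat -> R) : R := lsum A (fun k => v k * u k).

Lemma dot_comm A v u : dot A v u = dot A u v.
Proof. apply lsum_ext; intros; ring. Qed.

Lemma dot_comb A z c1 c2 u v :
  dot A z (fun k => c1 * u k + c2 * v k) = c1 * dot A z u + c2 * dot A z v.
Proof.
  unfold dot. rewrite <- !lsum_scal, <- lsum_plus. apply lsum_ext; intros; ring.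
Qed.

Lemma dot_scal A z c u : dot A z (fun k => c * u k) = c * dot A z u.
Proof. unfold dot. rewrite <- lsum_scal. apply lsum_ext; intros; ring. Qed.

Lemma dot_self_nonneg A u : 0 <= dot A u u.
Proof. apply lsum_nonneg; intros; nra. Qed.

Lemma cauchy_schwarz A u v : (dot A v u) ^ 2 <= dot A v v * dot A u u.
Proof.
  induction A as [|k A IH]; unfold dot in *; simpl; [lra|].
  set (p := lsum A (fun k => v k * u k)) in *.
  set (a := lsum A (fun k => v k * v k)) in *.
  set (b := lsum A (fun k => u k * u k)) in *.
  assert (Ha : 0 <= a) by (apply lsum_nonneg; intros; nra).
  assert (Hb : 0 <= b) by (apply lsum_nonneg; intros; nra).
  cut (2 * (v k * u k) * p <= v k * v k * b + a * (u k * u k)); [nra|].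
  apply Rle_trans with (2 * (Rabs (v k * u k) * sqrt (a * b))).
  - assert (Hp : Rabs p <= sqrt (a * b)).
    { rewrite <- sqrt_Rsqr_abs. apply sqrt_le_1_alt. unfold Rsqr. nra. }
    replace (2 * (v k * u k) * p) with (2 * ((v k * u k) * p)) by ring.
    apply Rmult_le_compat_l; [lra|]. eapply Rle_trans; [apply Rle_abs|].
    rewrite Rabs_mult. apply Rmult_le_compat_l; [apply Rabs_pos|exact Hp].
  - rewrite sqrt_mult by assumption. rewrite Rabs_mult.
    assert (H1 := sqrt_sqrt a Ha). assert (H2 := sqrt_sqrt b Hb).
    assert (H3 : Rabs (v k) * Rabs (v k) = v k * v k) by (rewrite <- Rabs_mult; apply Rabs_pos_eq; nra).
    assert (H4 : Rabs (u k) * Rabs (u k) = u k * u k) by (rewrite <- Rabs_mult; apply Rabs_pos_eq; nra).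
    rewrite <- H3, <- H4.
    assert (H5 := pow2_ge_0 (Rabs (v k) * sqrt b - Rabs (u k) * sqrt a)).
    replace ((Rabs (v k) * sqrt b - Rabs (u k) * sqrt a) ^ 2)
      with (Rabs (v k) * Rabs (v k) * (sqrt b * sqrt b)
            + sqrt a * sqrt a * (Rabs (u k) * Rabs (u k))
            - 2 * (Rabs (v k) * Rabs (u k) * (sqrt a * sqrt b))) in H5 by ring.
    rewrite H1, H2 in H5. lra.
Qed.

Definition basis_vec (k j : nat) : R := if Nat.eq_dec j k then 1 else 0.

Lemma dot_basis A k z : NoDup A -> In k A -> dot A z (basis_vec k) = z k.
Proof.
  unfold dot. induction 1 as [|j A Hj HA IH]; simpl; [easy|].
  intros [->|Hk].
  - rewrite lsum_0.
    + unfold basis_vec. destruct (Nat.eq_dec k k); [ring|easy].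
    + intros i Hi. unfold basis_vec. destruct (Nat.eq_dec i k); [congruence|ring].
  - rewrite IH by exact Hk. unfold basis_vec.
    destruct (Nat.eq_dec j k); [congruence|ring].
Qed.

Lemma dot_self_basis A u : NoDup A ->
  dot A u u = lsum A (fun k => dot A (basis_vec k) u ^ 2).
Proof.
  intros HA. apply lsum_ext; intros k Hk.
  rewrite dot_comm, dot_basis by assumption. ring.
Qed.

(** By plane rotations of pairs of vectors, the component along the functional [w] is
collected in the single vector [q].  Rotations preserve the sum of the squared
pairings with any [z], which is all that is remembered of orthonormality. *)
Lemma rotate_out A w us u0 :
  exists q us',
    (forall u, In u us' -> dot A w u = 0) /\
    (forall z, (forall u, In u (u0 :: us) -> dot A z u = 0) ->
       forall u, In u (q :: us') -> dot A z u = 0) /\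
    (forall z, dot A z q ^ 2 + lsum us' (fun u => dot A z u ^ 2) =
               lsum (u0 :: us) (fun u => dot A z u ^ 2)).
Proof.
  revert u0. induction us as [|u1 us IH]; intros u0.
  - exists u0, nil. simpl. repeat split; intros; tauto || auto.
  - destruct (IH u1) as (q0 & us0 & H1 & H2 & H3).
    set (c1 := dot A w u0). set (c2 := dot A w q0).
    destruct (Req_dec (c1 ^ 2 + c2 ^ 2) 0) as [Hr|Hr].
    + exists q0, (u0 :: us0). split; [|split].
      * intros u [<-|Hu]; [|auto]. unfold c1 in *. nra.
      * intros z Hz u Hu. simpl in Hu. destruct Hu as [Hu|[Hu|Hu]].
        -- subst u. apply H2; [|now left]. intros v Hv. apply Hz. now right.
        -- subst u. apply Hz. now left.
        -- apply H2; [|now right]. intros v Hv. apply Hz. now right.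
      * intros z. specialize (H3 z). simpl in *. lra.
    + set (r := sqrt (c1 ^ 2 + c2 ^ 2)).
      assert (Hpos : 0 < c1 ^ 2 + c2 ^ 2) by nra.
      assert (Hr0 : 0 < r) by (apply sqrt_lt_R0; exact Hpos).
      assert (Hr2 : r * r = c1 ^ 2 + c2 ^ 2) by (apply sqrt_sqrt; lra).
      exists (fun k => c1 / r * u0 k + c2 / r * q0 k),
             ((fun k => c2 / r * u0 k + (- c1 / r) * q0 k) :: us0).
      split; [|split].
      * intros u [<-|Hu]; [|auto]. rewrite dot_comb. fold c1 c2. field. lra.
      * intros z Hz.
        assert (Hz0 : dot A z u0 = 0) by (apply Hz; now left).
        assert (Hz1 : forall u, In u (q0 :: us0) -> dot A z u = 0).
        { apply H2. intros u Hu. apply Hz. now right. }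
        assert (Hq0 : dot A z q0 = 0) by (apply Hz1; now left).
        intros u [<-|[<-|Hu]].
        -- rewrite dot_comb, Hz0, Hq0. ring.
        -- rewrite dot_comb, Hz0, Hq0. ring.
        -- apply Hz1. now right.
      * intros z. specialize (H3 z). simpl in *. rewrite <- H3, !dot_comb.
        set (p := dot A z u0). set (q := dot A z q0).
        set (T := lsum us0 _).
        replace ((c1 / r * p + c2 / r * q) * ((c1 / r * p + c2 / r * q) * 1) +
          ((c2 / r * p + - c1 / r * q) * ((c2 / r * p + - c1 / r * q) * 1) + T))
          with ((c1 ^ 2 + c2 ^ 2) / (r * r) * (p * p + q * q) + T) by (field; lra).
        rewrite Hr2. field. lra.
Qed.

(** The family plays the role of an orthonormal basis of the common kernel of the
functionals in [ws]: the second clause is Bessel's inequality, the third bounds the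
dimension from below.  Each functional costs one rotated vector, which has norm at
most 1 because of Bessel's inequality itself. *)
Lemma kernel_frame A (ws : list (nat -> R)) : NoDup A ->
  exists us : list (nat -> R),
    (forall u w, In u us -> In w ws -> dot A w u = 0) /\
    (forall z, lsum us (fun u => dot A z u ^ 2) <= dot A z z) /\
    INR (length A) - INR (length ws) <= lsum us (fun u => dot A u u).
Proof.
  intros HA. induction ws as [|w ws (us & H1 & H2 & H3)].
  - exists (map basis_vec A). repeat split.
    + intros u w _ [].
    + intros z. rewrite lsum_map. apply Req_le, lsum_ext. intros k Hk.
      rewrite dot_basis by assumption. ring.
    + rewrite lsum_map. simpl. rewrite (lsum_ext A _ (fun _ => 1)).
      * rewrite lsum_const. lra.
      * intros k Hk. rewrite dot_basis by assumption. unfold basis_vec.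
        now destruct (Nat.eq_dec k k).
  - destruct us as [|u0 us].
    { exists nil. simpl length. rewrite S_INR. simpl in *.
      repeat split; [easy|exact H2|lra]. }
    destruct (rotate_out A w us u0) as (q & us' & G1 & G2 & G3).
    exists us'. split; [|split].
    + intros u v Hu [<-|Hv]; [now apply G1|].
      apply (G2 v); [|now right]. intros t Ht. now apply H1.
    + intros z. specialize (G3 z). specialize (H2 z).
      pose proof (pow2_ge_0 (dot A z q)). lra.
    + assert (Hq : dot A q q <= 1).
      { assert (H := H2 q). rewrite <- G3 in H.
        assert (0 <= lsum us' (fun u => dot A q u ^ 2))
          by (apply lsum_nonneg; intros; apply pow2_ge_0).
        pose proof (dot_self_nonneg A q). nra. }
      assert (Htr : lsum us' (fun u => dot A u u) + dot A q q =
                    lsum (u0 :: us) (fun u => dot A u u)).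
      { rewrite (lsum_ext us' _ _ (fun u _ => dot_self_basis A u HA)).
        rewrite (lsum_ext (u0 :: us) _ _ (fun u _ => dot_self_basis A u HA)).
        rewrite (dot_self_basis A q HA), !(lsum_swap _ A), <- lsum_plus.
        apply lsum_ext. intros k _. rewrite <- G3. ring. }
      simpl length. rewrite S_INR. lra.
Qed.

(** * Discrepancy: rounding and ordering with error of fourth-root type *)

(** The quadratic form [u -> sum_v wt v (v.u)^2] has trace at most [a * sum wt], while
the kernel of the constraints has dimension at least [a / 4]; some direction of that
kernel does no worse than the average. *)
Lemma good_direction A (rows ws : list (nat -> R)) (wt : (nat -> R) -> R) :
  NoDup A -> 0 < INR (length A) ->
  (forall v k, In v rows -> In k A -> Rabs (v k) <= 1) ->
  (forall v, In v rows -> 0 <= wt v) ->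
  INR (length ws) <= 3 / 4 * INR (length A) ->
  exists u, dot A u u = 1 /\ (forall w, In w ws -> dot A w u = 0) /\
    lsum rows (fun v => wt v * dot A v u ^ 2) <= 4 * lsum rows wt.
Proof.
  intros HA Ha Hv Hw Hws.
  destruct (kernel_frame A ws HA) as (us & H1 & H2 & H3).
  set (a := INR (length A)) in *. set (T := lsum rows wt).
  set (Q := fun u => lsum rows (fun v => wt v * dot A v u ^ 2)).
  assert (HT : 0 <= T) by now apply lsum_nonneg.
  assert (HQ : lsum us Q <= a * T).
  { unfold Q. rewrite lsum_swap. unfold T. rewrite <- lsum_scal.
    apply lsum_le; intros v Hvr. rewrite lsum_scal, Rmult_comm.
    apply Rmult_le_compat_r; [auto|]. eapply Rle_trans; [apply H2|].
    replace a with (INR (length A) * 1) by (unfold a; ring). rewrite <- lsum_const.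
    apply lsum_le; intros k Hk. specialize (Hv v k Hvr Hk).
    apply Rabs_le_between in Hv. nra. }
  assert (Hex : exists u, In u us /\ 0 < dot A u u /\ Q u <= 4 * T * dot A u u).
  { destruct (Classical_Prop.classic
      (exists u, In u us /\ 0 < dot A u u /\ Q u <= 4 * T * dot A u u)) as [H|H];
      [exact H|exfalso].
    assert (Hall : forall u, In u us -> 0 < dot A u u -> 4 * T * dot A u u < Q u).
    { intros u Hu Hp. apply Rnot_le_lt. intros Hc. apply H. eauto. }
    assert (Hpos : exists u, In u us /\ 0 < dot A u u).
    { destruct (Classical_Prop.classic (exists u, In u us /\ 0 < dot A u u)) as [H'|H'];
        [exact H'|exfalso].
      rewrite lsum_0 in H3; [lra|]. intros u Hu.
      pose proof (dot_self_nonneg A u).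
      destruct (Rle_lt_or_eq_dec 0 _ H0) as [Hlt|Heq]; [|lra].
      exfalso; apply H'; eauto. }
    destruct Hpos as (u & Hu & Hp).
    assert (Hlt : lsum us (fun u => 4 * T * dot A u u) < lsum us Q).
    { apply lsum_lt with u; [|exact Hu|auto]. intros t Ht.
      pose proof (dot_self_nonneg A t) as H0.
      destruct (Rle_lt_or_eq_dec 0 _ H0) as [Hlt|Heq]; [left; auto|].
      rewrite <- Heq, Rmult_0_r. apply lsum_nonneg. intros v Hvr.
      apply Rmult_le_pos; [auto|apply pow2_ge_0]. }
    rewrite lsum_scal in Hlt. nra. }
  destruct Hex as (u & Hu & Hp & Hle).
  set (r := sqrt (dot A u u)).
  assert (Hr : 0 < r) by (apply sqrt_lt_R0; exact Hp).
  assert (Hrr : r * r = dot A u u) by (apply sqrt_sqrt; lra).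
  exists (fun k => / r * u k). split; [|split].
  - rewrite dot_scal, dot_comm, dot_scal, <- Hrr. field. lra.
  - intros w Hw'. rewrite dot_scal, (H1 u w) by assumption. ring.
  - apply Rle_trans with (/ (r * r) * Q u).
    + apply Req_le. unfold Q. rewrite <- lsum_scal. apply lsum_ext; intros v _.
      rewrite dot_scal. field. lra.
    + apply Rmult_le_reg_l with (r * r); [nra|].
      rewrite <- Rmult_assoc, Rinv_r, Rmult_1_l by nra. fold T. rewrite Hrr. lra.
Qed.

(** Either a full unit of time can be spent in direction [u], or the motion stops when a
further coordinate reaches the boundary of the cube. *)
Lemma hit_boundary (A : list nat) (x u : nat -> R) :
  (forall k, In k A -> Rabs (x k) <= 1) ->
  (forall k, In k A -> Rabs (x k) < 1 \/ u k = 0) ->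
  exists t, 0 <= t <= 1 /\ (forall k, In k A -> Rabs (x k + t * u k) <= 1) /\
    (t = 1 \/ exists k, In k A /\ Rabs (x k) < 1 /\ Rabs (x k + t * u k) = 1).
Proof.
  induction A as [|j A IH]; intros Hx Hu.
  - exists 1. split; [lra|]. split; [easy|now left].
  - destruct IH as (t & Ht & Hin & Hor); [intros; apply Hx; now right|intros; apply Hu; now right|].
    assert (Hxj := Hx j (or_introl eq_refl)).
    assert (Hshrink : forall t', 0 <= t' <= t -> forall k, In k A -> Rabs (x k + t' * u k) <= 1).
    { intros t' Ht' k Hk. assert (H1 := Hin k Hk). assert (H2 := Hx k (or_intror Hk)).
      apply Rabs_le_between in H1. apply Rabs_le_between in H2. apply Rabs_le_between.
      destruct (Rle_dec 0 (u k)); split; nra. }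
    assert (Hcut : forall t', 0 <= t' <= t -> u j <> 0 -> Rabs (x j + t' * u j) = 1 ->
      exists t, 0 <= t <= 1 /\ (forall k, In k (j :: A) -> Rabs (x k + t * u k) <= 1) /\
      (t = 1 \/ exists k, In k (j :: A) /\ Rabs (x k) < 1 /\ Rabs (x k + t * u k) = 1)).
    { intros t' Ht' Hne H1. exists t'. split; [lra|]. split.
      - intros k [<-|Hk]; [lra|]. now apply Hshrink.
      - right. exists j. split; [now left|]. split; [|exact H1].
        destruct (Hu j (or_introl eq_refl)); [assumption|contradiction]. }
    apply Rabs_le_between in Hxj.
    destruct (Rle_dec (x j + t * u j) 1) as [Hup|Hup].
    + destruct (Rle_dec (-1) (x j + t * u j)) as [Hlo|Hlo].
      * exists t. split; [lra|]. split.
        -- intros k [<-|Hk]; [apply Rabs_le_between; lra|auto].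
        -- destruct Hor as [->|(k & Hk & H1)]; [now left|].
           right. exists k. split; [now right|exact H1].
      * assert (u j < 0) by nra.
        apply (Hcut ((-1 - x j) / u j)); [|lra|].
        -- split.
           ++ replace ((-1 - x j) / u j) with ((1 + x j) * / (- u j)) by (field; lra).
              apply Rmult_le_pos; [lra|]. left. apply Rinv_0_lt_compat. lra.
           ++ apply Rmult_le_reg_r with (- u j); [lra|].
              replace ((-1 - x j) / u j * - u j) with (1 + x j) by (field; lra). lra.
        -- replace (x j + (-1 - x j) / u j * u j) with (-1) by (field; lra).
           rewrite Rabs_left; lra.
    + assert (0 < u j) by nra.
      apply (Hcut ((1 - x j) / u j)); [|lra|].
      * split.
        -- apply Rmult_le_pos; [lra|]. left. now apply Rinv_0_lt_compat.
        -- apply Rmult_le_reg_r with (u j); [lra|].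
           replace ((1 - x j) / u j * u j) with (1 - x j) by (field; lra). lra.
      * replace (x j + (1 - x j) / u j * u j) with 1 by (field; lra).
        apply Rabs_R1.
Qed.

(** A quartic potential obeys the same second order inequality as a hyperbolic cosine,
with an exact finite expansion.  The first order term is isolated because the walk is
orthogonal to the gradient. *)
Lemma quartic_step tau s h : 0 <= tau -> tau * h ^ 2 <= 1 ->
  1 + tau ^ 2 * (s + h) ^ 4 <=
  1 + tau ^ 2 * s ^ 4 + 4 * tau ^ 2 * (s ^ 3 * h)
  + 7 * tau * ((1 + tau ^ 2 * s ^ 4) * h ^ 2).
Proof.
  intros Ht Hh.
  set (q := tau * s ^ 2). set (y := tau * h ^ 2) in *.
  assert (Hy : 0 <= y) by (unfold y; pose proof (pow2_ge_0 h); nra).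
  assert (Hcross : 4 * tau * (s * h) <= 2 * q + 2 * y).
  { unfold q, y. pose proof (pow2_ge_0 (s - h)). nra. }
  cut (y * (6 * q + 4 * tau * (s * h) + y) <= y * (7 * (1 + q ^ 2))).
  { intros H. unfold q, y in *.
    match type of H with ?L <= ?R =>
      replace (1 + tau ^ 2 * (s + h) ^ 4) with
        (1 + tau ^ 2 * s ^ 4 + 4 * tau ^ 2 * (s ^ 3 * h) + L) by ring;
      replace (7 * tau * ((1 + tau ^ 2 * s ^ 4) * h ^ 2)) with R by ring end.
    lra. }
  apply Rmult_le_compat_l; [exact Hy|].
  pose proof (pow2_ge_0 (q - 4 / 7)). nra.
Qed.

Definition root4_mul (N a : R) : R := sqrt (sqrt (N * a)).

Lemma root4_mul_pow4 N a : 0 <= N * a -> root4_mul N a ^ 4 = N * a.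
Proof.
  intros H. unfold root4_mul.
  replace (sqrt (sqrt (N * a)) ^ 4) with
    ((sqrt (sqrt (N * a)) * sqrt (sqrt (N * a))) *
     (sqrt (sqrt (N * a)) * sqrt (sqrt (N * a)))) by ring.
  rewrite (sqrt_sqrt (sqrt (N * a))) by apply sqrt_pos. now apply sqrt_sqrt.
Qed.

Lemma root4_mul_pos N a : 0 <= root4_mul N a.
Proof. apply sqrt_pos. Qed.

Lemma root4_mul_ge N a y : 0 <= N * a -> y ^ 4 <= N * a -> y <= root4_mul N a.
Proof.
  intros H Hy. apply Rnot_lt_le. intros Hlt.
  assert (H4 := root4_mul_pow4 N a H). assert (Hp := root4_mul_pos N a).
  assert (root4_mul N a ^ 2 < y ^ 2) by nra.
  assert (0 <= root4_mul N a ^ 2) by apply pow2_ge_0. nra.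
Qed.

Lemma root4_mul_le N a y : 0 <= N * a -> 0 <= y -> N * a <= y ^ 4 -> root4_mul N a <= y.
Proof.
  intros H Hy Hle. apply Rnot_lt_le. intros Hlt.
  assert (H4 := root4_mul_pow4 N a H).
  assert (y ^ 2 < root4_mul N a ^ 2) by nra.
  assert (0 <= y ^ 2) by apply pow2_ge_0. nra.
Qed.

(** Coordinates in the interior of the cube, which may still move. *)
Definition freeb (x : nat -> R) (k : nat) : bool :=
  if Rlt_dec (Rabs (x k)) 1 then true else false.

Definition displacement A (x0 x v : nat -> R) : R := dot A v (fun k => x k - x0 k).

Definition potential A (rows : list (nat -> R)) x0 x : R :=
  lsum rows (fun v => 1 + (/ (56 * INR (length A))) ^ 2 * displacement A x0 x v ^ 4).

(** The last clause ties the growth of the potential to the squared distance from the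
origin.  That distance is at most [a] in the cube, so the potential never exceeds
[2 N]. *)
Definition walk_inv A (rows : list (nat -> R)) x0 x : Prop :=
  let a := INR (length A) in
  let N := INR (length rows) in
  (forall k, In k A -> Rabs (x k) <= 1) /\
  (forall v, In v rows -> Rabs (displacement A x0 x v) <= 16 * root4_mul N a) /\
  potential A rows x0 x <= N + N / a * dot A x x.

Lemma dot_self_le A (x : nat -> R) : (forall k, In k A -> Rabs (x k) <= 1) -> dot A x x <= INR (length A).
Proof.
  intros H. rewrite <- (Rmult_1_r (INR _)), <- lsum_const. apply lsum_le.
  intros k Hk. specialize (H k Hk). apply Rabs_le_between in H. nra.
Qed.

Definition tightb A x0 x (b : R) (v : nat -> R) : bool :=
  if Rle_dec b (Rabs (displacement A x0 x v)) then true else false.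

(** A form displaced by [15 (N a)^(1/4)] contributes at least [50625 / 3136 * N / a] to a
potential that is at most [2 N]. *)
Lemma few_tight A rows x0 x :
  0 < INR (length A) -> INR (length A) <= INR (length rows) ->
  walk_inv A rows x0 x ->
  INR (length (filter (tightb A x0 x (15 * root4_mul (INR (length rows)) (INR (length A)))) rows))
    <= INR (length A) / 8.
Proof.
  intros Ha HN (Hx & _ & Hpot).
  set (a := INR (length A)) in *. set (N := INR (length rows)) in *.
  set (E := root4_mul N a). set (fr := filter _ rows).
  assert (HE : E ^ 4 = N * a) by (apply root4_mul_pow4; nra).
  assert (HEp : 0 <= E) by apply root4_mul_pos.
  assert (H2N : potential A rows x0 x <= 2 * N).
  { eapply Rle_trans; [exact Hpot|].
    assert (H := dot_self_le A x Hx). fold a in H.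
    assert (N / a * dot A x x <= N / a * a).
    { apply Rmult_le_compat_l; [|exact H]. apply Rmult_le_pos; [lra|].
      left; now apply Rinv_0_lt_compat. }
    replace (N / a * a) with N in H0 by (field; lra). lra. }
  assert (Hlow : INR (length fr) * ((/ (56 * a)) ^ 2 * (15 * E) ^ 4) <= potential A rows x0 x).
  { rewrite <- lsum_const. unfold fr. rewrite lsum_filter. apply lsum_le.
    intros v Hv. unfold tightb. fold a. set (s := displacement A x0 x v).
    assert (0 <= (/ (56 * a)) ^ 2) by apply pow2_ge_0.
    destruct (Rle_dec _ _) as [Hb|Hb].
    - assert (Hs4 : (15 * E) ^ 4 <= s ^ 4).
      { replace (s ^ 4) with (Rabs s ^ 4).
        - apply pow_incr. lra.
        - rewrite RPow_abs. apply Rabs_pos_eq. replace (s ^ 4) with ((s ^ 2) ^ 2) by ring.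
          apply pow2_ge_0. }
      nra.
    - assert (0 <= s ^ 4) by (replace (s ^ 4) with ((s ^ 2) ^ 2) by ring; apply pow2_ge_0).
      nra. }
  replace ((/ (56 * a)) ^ 2 * (15 * E) ^ 4) with (50625 / 3136 * (N / a)) in Hlow.
  2:{ replace ((15 * E) ^ 4) with (50625 * E ^ 4) by ring. rewrite HE. field. lra. }
  set (c := INR (length fr)) in *.
  apply Rmult_le_reg_r with (50625 / 3136 * (N / a)).
  - apply Rmult_lt_0_compat; [lra|]. apply Rdiv_lt_0_compat; lra.
  - replace (a / 8 * (50625 / 3136 * (N / a))) with (50625 / 25088 * N) by (field; lra).
    lra.
Qed.

Lemma length_filter_split {B} (p : B -> bool) l :
  INR (length (filter p l)) + INR (length (filter (fun b => negb (p b)) l)) = INR (length l).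
Proof. rewrite <- plus_INR. f_equal. apply filter_length. Qed.

(** The number of moving coordinates minus the squared norm drops by at least 1: either a
coordinate gets fixed, or the point moves by a unit vector orthogonal to its position. *)
Lemma walk_step A rows x0 x :
  NoDup A -> 16 <= INR (length A) -> INR (length A) <= INR (length rows) ->
  (forall v k, In v rows -> In k A -> Rabs (v k) <= 1) ->
  walk_inv A rows x0 x ->
  INR (length A) / 2 < INR (length (filter (freeb x) A)) ->
  exists x', walk_inv A rows x0 x' /\
    INR (length (filter (freeb x') A)) - dot A x' x' + 1 <=
    INR (length (filter (freeb x) A)) - dot A x x.
Proof.
  intros HA Ha HN Hrow Hinv Hfree.
  assert (Htight := few_tight A rows x0 x ltac:(lra) HN Hinv).
  destruct Hinv as (Hx & Hs & Hpot).
  set (a := INR (length A)) in *. set (N := INR (length rows)) in *.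
  set (E := root4_mul N a) in *. set (tight := filter _ rows) in Htight.
  (* This scale makes the growth 7 tau t^2 * 4 * (2 N) of the potential in one
     step equal to N / a * t^2, the growth allowed by the invariant. *)
  set (tau := / (56 * a)).
  assert (Htau : 0 < tau) by (apply Rinv_0_lt_compat; lra).
  set (s := displacement A x0 x).
  set (wt := fun v => 1 + tau ^ 2 * s v ^ 4).
  assert (Hwt : forall v, 0 <= wt v).
  { intros v. unfold wt. assert (0 <= (tau * s v ^ 2) ^ 2) by apply pow2_ge_0. nra. }
  set (grad := fun k => lsum rows (fun v => s v ^ 3 * v k)).
  (* At most a/2 fixed coordinates, a/8 displaced forms and two further
     constraints: at most 3a/4 in all, because 16 <= a. *)
  set (ws := map basis_vec (filter (fun k => negb (freeb x k)) A) ++ tight ++ [grad; x]).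
  destruct (good_direction A rows ws wt) as (u & Hu1 & Hker & HQ); auto; [fold a; lra| |].
  { fold a. unfold ws. rewrite !length_app, length_map. simpl length.
    rewrite !plus_INR. simpl INR.
    assert (H := length_filter_split (freeb x) A). fold a in H. lra. }
  assert (Hux : dot A x u = 0).
  { apply Hker. unfold ws. rewrite !in_app_iff. right; right; simpl; auto. }
  assert (Hug : dot A grad u = 0).
  { apply Hker. unfold ws. rewrite !in_app_iff. right; right; simpl; auto. }
  assert (Hufree : forall k, In k A -> Rabs (x k) < 1 \/ u k = 0).
  { intros k Hk. destruct (Rlt_dec (Rabs (x k)) 1) as [Hlt|Hge]; [now left|right].
    rewrite <- (dot_basis A k u HA Hk), dot_comm. apply Hker.
    unfold ws. rewrite !in_app_iff. left. apply in_map, filter_In. split; [exact Hk|].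
    unfold freeb. now destruct (Rlt_dec (Rabs (x k)) 1). }
  destruct (hit_boundary A x u Hx Hufree) as (t & Ht & Hx' & Hhit).
  set (x' := fun k => x k + t * u k) in *.
  assert (Hdisp : forall v, displacement A x0 x' v = s v + t * dot A v u).
  { intros v. unfold s, displacement, dot, x'. rewrite <- lsum_scal, <- lsum_plus.
    apply lsum_ext; intros; ring. }
  assert (Hnorm : dot A x' x' = dot A x x + t ^ 2).
  { transitivity (dot A x x + 2 * t * dot A x u + t ^ 2 * dot A u u).
    - unfold dot, x'. rewrite <- !lsum_scal, <- !lsum_plus. apply lsum_ext; intros; ring.
    - rewrite Hux, Hu1. ring. }
  assert (Hvu : forall v, In v rows -> dot A v u ^ 2 <= a).
  { intros v Hv. eapply Rle_trans; [apply cauchy_schwarz|]. rewrite Hu1, Rmult_1_r.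
    apply dot_self_le. auto. }
  exists x'. split; [split; [|split]|].
  - exact Hx'.
  - intros v Hv. fold a N E. rewrite Hdisp.
    destruct (Rle_dec (15 * E) (Rabs (s v))) as [Hb|Hb].
    + replace (dot A v u) with 0; [rewrite Rmult_0_r, Rplus_0_r; now apply Hs|].
      symmetry. apply Hker. unfold ws. rewrite !in_app_iff. right; left.
      apply filter_In. split; [exact Hv|]. unfold tightb. fold a N E. fold (s v).
      now destruct (Rle_dec (15 * E) (Rabs (s v))).
    + eapply Rle_trans; [apply Rabs_triang|].
      assert (Rabs (t * dot A v u) <= E).
      { rewrite Rabs_mult, (Rabs_pos_eq t) by lra.
        apply Rle_trans with (Rabs (dot A v u)).
        - pose proof (Rabs_pos (dot A v u)). nra.
        - apply root4_mul_ge; [nra|]. specialize (Hvu v Hv).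
          rewrite RPow_abs, Rabs_pos_eq; [|replace (dot A v u ^ 4) with ((dot A v u ^ 2) ^ 2) by ring; apply pow2_ge_0].
          replace (dot A v u ^ 4) with (dot A v u ^ 2 * dot A v u ^ 2) by ring.
          pose proof (pow2_ge_0 (dot A v u)). nra. }
      lra.
  - fold a N.
    assert (Hpot2 : lsum rows wt <= 2 * N).
    { eapply Rle_trans; [exact Hpot|]. assert (H := dot_self_le A x Hx). fold a in H.
      assert (N / a * dot A x x <= N / a * a).
      { apply Rmult_le_compat_l; [|exact H]. apply Rmult_le_pos; [lra|].
        left; apply Rinv_0_lt_compat; lra. }
      replace (N / a * a) with N in H0 by (field; lra). lra. }
    assert (Hstep : potential A rows x0 x' <=
      lsum rows wt + 4 * tau ^ 2 * t * dot A grad u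
      + 7 * tau * t ^ 2 * lsum rows (fun v => wt v * dot A v u ^ 2)).
    { replace (dot A grad u) with (lsum rows (fun v => s v ^ 3 * dot A v u)).
      - rewrite <- !lsum_scal, <- !lsum_plus. apply lsum_le. intros v Hv.
        fold a tau. rewrite Hdisp.
        eapply Rle_trans; [apply (quartic_step tau (s v) (t * dot A v u)); [lra|]|].
        + specialize (Hvu v Hv).
          apply Rle_trans with (tau * a).
          * apply Rmult_le_compat_l; [lra|].
            replace ((t * dot A v u) ^ 2) with (t ^ 2 * dot A v u ^ 2) by ring.
            pose proof (pow2_ge_0 (dot A v u)). assert (t ^ 2 <= 1) by nra. nra.
          * unfold tau. replace (/ (56 * a) * a) with (/ 56) by (field; lra). lra.
        + unfold wt. apply Req_le. ring.
      - unfold dot at 2. unfold grad.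
        rewrite (lsum_ext A _ (fun k => lsum rows (fun v => s v ^ 3 * (v k * u k)))).
        + rewrite lsum_swap. apply lsum_ext; intros v _. now rewrite lsum_scal.
        + intros k _. rewrite Rmult_comm, <- lsum_scal. apply lsum_ext; intros; ring. }
    rewrite Hug in Hstep. eapply Rle_trans; [exact Hstep|].
    rewrite Hnorm.
    assert (7 * tau * t ^ 2 * lsum rows (fun v => wt v * dot A v u ^ 2)
            <= 7 * tau * t ^ 2 * (8 * N)).
    { apply Rmult_le_compat_l; [|lra]. pose proof (pow2_ge_0 t). nra. }
    replace (7 * tau * t ^ 2 * (8 * N)) with (N / a * t ^ 2) in H by (unfold tau; field; lra).
    change (lsum rows wt <= N + N / a * dot A x x) in Hpot. lra.
  - rewrite Hnorm.
    assert (Hsub : forall k, In k A -> freeb x' k = true -> freeb x k = true).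
    { intros k Hk Hf. unfold freeb in *.
      destruct (Rlt_dec (Rabs (x k)) 1) as [|Hge]; [reflexivity|].
      destruct (Hufree k Hk) as [|H0]; [contradiction|].
      unfold x' in Hf. rewrite H0, Rmult_0_r, Rplus_0_r in Hf.
      now destruct (Rlt_dec (Rabs (x k)) 1). }
    assert (Hincl : incl (filter (freeb x') A) (filter (freeb x) A)).
    { intros k Hk. apply filter_In in Hk. apply filter_In. split; [tauto|apply Hsub; tauto]. }
    assert (Hnd : NoDup (filter (freeb x') A)) by now apply NoDup_filter.
    destruct Hhit as [->|(k & Hk & Hk1 & Hk2)].
    + assert (H := NoDup_incl_length Hnd Hincl). apply le_INR in H. lra.
    + assert (Hd : NoDup (k :: filter (freeb x') A)).
      { constructor; [|exact Hnd]. intros H. apply filter_In in H. destruct H as [_ H].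
        unfold freeb, x' in H. destruct (Rlt_dec _ 1) in H; [lra|easy]. }
      assert (Hi : incl (k :: filter (freeb x') A) (filter (freeb x) A)).
      { intros j [<-|Hj]; [|auto]. apply filter_In. split; [exact Hk|].
        unfold freeb. now destruct (Rlt_dec (Rabs (x k)) 1). }
      assert (H := NoDup_incl_length Hd Hi). apply le_INR in H. simpl length in H.
      rewrite S_INR in H. pose proof (pow2_ge_0 t). lra.
Qed.

(** The quantity decreased by the walk lies between [-a] and [a], so the walk stops after
at most about [2 a] steps. *)
Lemma partial_coloring A (rows : list (nat -> R)) (x0 : nat -> R) :
  NoDup A -> 16 <= INR (length A) -> INR (length A) <= INR (length rows) ->
  (forall v k, In v rows -> In k A -> Rabs (v k) <= 1) ->
  (forall k, In k A -> Rabs (x0 k) <= 1) ->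
  exists x, (forall k, In k A -> Rabs (x k) <= 1) /\
    (forall v, In v rows -> Rabs (displacement A x0 x v) <=
       16 * root4_mul (INR (length rows)) (INR (length A))) /\
    INR (length (filter (freeb x) A)) <= INR (length A) / 2.
Proof.
  intros HA Ha HN Hrow Hx0.
  assert (Hiter : forall m x, walk_inv A rows x0 x ->
    INR (length (filter (freeb x) A)) - dot A x x + INR (length A) <= INR m ->
    exists x', walk_inv A rows x0 x' /\
      INR (length (filter (freeb x') A)) <= INR (length A) / 2).
  { induction m as [|m IH]; intros x Hinv Hm;
    destruct (Rle_dec (INR (length (filter (freeb x) A))) (INR (length A) / 2)) as [Hle|Hgt];
      try (exists x; now split).
    - exfalso. assert (H := dot_self_le A x (proj1 Hinv)). simpl INR in Hm. lra.
    - destruct (walk_step A rows x0 x) as (x' & Hinv' & Hdec); auto; [lra|].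
      apply (IH x' Hinv'). rewrite S_INR in Hm. lra. }
  assert (Hz : forall v, displacement A x0 x0 v = 0).
  { intros v. apply lsum_0. intros; ring. }
  destruct (INR_unbounded (INR (length (filter (freeb x0) A)) - dot A x0 x0 + INR (length A)))
    as [m Hm].
  destruct (Hiter m x0) as (x & (H1 & H2 & _) & H3); [|lra|now exists x].
  split; [exact Hx0|split].
  - intros v _. rewrite Hz, Rabs_R0. pose proof (root4_mul_pos (INR (length rows)) (INR (length A))). lra.
  - unfold potential. rewrite (lsum_ext rows _ (fun _ => 1)).
    + rewrite lsum_const, Rmult_1_r.
      assert (0 <= INR (length rows) / INR (length A) * dot A x0 x0); [|lra].
      apply Rmult_le_pos; [|apply dot_self_nonneg].
      apply Rmult_le_pos; [lra|]. left; apply Rinv_0_lt_compat; lra.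
    + intros v _. rewrite Hz. ring.
Qed.

(** The error bound decays geometrically with the number of variables; the sums of errors
over successive halvings are geometric series for this reason. *)
Lemma root4_mul_shrink N a b r : 0 <= N -> 0 <= a -> 0 <= r -> 0 <= b -> b <= r ^ 4 * a ->
  root4_mul N b <= r * root4_mul N a.
Proof.
  intros HN Ha Hr Hb0 Hb. apply root4_mul_le.
  - nra.
  - pose proof (root4_mul_pos N a). nra.
  - rewrite Rpow_mult_distr, root4_mul_pow4 by nra. nra.
Qed.

(** Partial colorings are iterated on the coordinates that still move.  Their number is at
least halved each time, so the errors form a geometric series of ratio [17/20]. *)
Lemma full_coloring A (rows : list (nat -> R)) (x0 : nat -> R) :
  NoDup A -> INR (length A) <= INR (length rows) ->
  (forall v k, In v rows -> In k A -> Rabs (v k) <= 1) ->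
  (forall k, In k A -> Rabs (x0 k) <= 1) ->
  exists x, (forall k, In k A -> x k = 1 \/ x k = -1) /\
    (forall v, In v rows -> Rabs (displacement A x0 x v) <=
       108 * root4_mul (INR (length rows)) (INR (length A))).
Proof.
  remember (length A) as n eqn:Hn. revert A Hn x0.
  induction n as [n IH] using (well_founded_induction Nat.lt_wf_0).
  intros A Hn x0 HA HN Hrow Hx0.
  set (N := INR (length rows)) in *.
  pose proof (pos_INR n) as Hn0.
  destruct (Rle_dec 16 (INR n)) as [Hbig|Hsmall].
  - destruct (partial_coloring A rows x0) as (x1 & H1 & H2 & H3); try (rewrite <- Hn); auto.
    rewrite <- Hn in H2, H3. fold N in H2.
    set (A' := filter (freeb x1) A) in *.
    assert (HA'A : forall k, In k A' -> In k A) by (intros k Hk; apply filter_In in Hk; tauto).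
    destruct (IH (length A')) with (A := A') (x0 := x1) as (x2 & G1 & G2); auto.
    + apply INR_lt. lra.
    + now apply NoDup_filter.
    + lra.
    + exists (fun k => if freeb x1 k then x2 k else x1 k). split.
      * intros k Hk. destruct (freeb x1 k) eqn:Hf.
        -- apply G1. now apply filter_In.
        -- unfold freeb in Hf. destruct (Rlt_dec _ 1) in Hf; [easy|].
           specialize (H1 k Hk). assert (Hr : Rabs (x1 k) = 1) by lra.
           unfold Rabs in Hr. destruct (Rcase_abs (x1 k)); lra.
      * intros v Hv. fold N.
        assert (Heq : displacement A x0 (fun k => if freeb x1 k then x2 k else x1 k) v =
                      displacement A x0 x1 v + displacement A' x1 x2 v).
        { unfold displacement, dot, A'. rewrite lsum_filter, <- lsum_plus.
          apply lsum_ext; intros k _. destruct (freeb x1 k); ring. }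
        rewrite Heq. eapply Rle_trans; [apply Rabs_triang|].
        specialize (H2 v Hv). specialize (G2 v Hv). fold N in G2.
        assert (root4_mul N (INR (length A')) <= 17 / 20 * root4_mul N (INR n)).
        { apply root4_mul_shrink; try lra. apply pos_INR. }
        pose proof (root4_mul_pos N (INR n)). lra.
  - exists (fun _ => 1). split; [now left|]. intros v Hv. fold N.
    apply Rle_trans with (INR (length A) * 2).
    + apply lsum_abs_le. intros k Hk. rewrite Rabs_mult.
      specialize (Hrow v k Hv Hk). specialize (Hx0 k Hk).
      assert (Rabs (1 - x0 k) <= 2).
      { apply Rabs_le_between in Hx0. apply Rabs_le_between. lra. }
      pose proof (Rabs_pos (v k)). pose proof (Rabs_pos (1 - x0 k)). nra.
    + rewrite <- Hn. set (a := INR n) in *.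
      assert (a / 8 <= root4_mul N a); [|lra].
      apply root4_mul_ge; [nra|].
      assert (a ^ 2 <= 256) by nra. assert (0 <= a ^ 2) by nra.
      replace ((a / 8) ^ 4) with (a ^ 2 * (a ^ 2 / 4096)) by field. nra.
Qed.

(** The affine map sending 0 and 1 to -1 and 1 turns weights into a point of the cube. *)
Lemma subset_rounding A (rows : list (nat -> R)) (p : nat -> R) :
  NoDup A -> INR (length A) <= INR (length rows) ->
  (forall v k, In v rows -> In k A -> Rabs (v k) <= 1) ->
  (forall k, In k A -> 0 <= p k <= 1) ->
  exists b : nat -> bool, forall v, In v rows ->
    Rabs (lsum (filter b A) v - lsum A (fun k => p k * v k)) <=
      54 * root4_mul (INR (length rows)) (INR (length A)).
Proof.
  intros HA HN Hrow Hp.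
  destruct (full_coloring A rows (fun k => 2 * p k - 1)) as (x & H1 & H2); auto.
  { intros k Hk. specialize (Hp k Hk). apply Rabs_le_between. lra. }
  exists (fun k => if Rlt_dec 0 (x k) then true else false).
  intros v Hv. specialize (H2 v Hv).
  replace (lsum _ v - _) with (/ 2 * displacement A (fun k => 2 * p k - 1) x v).
  - rewrite Rabs_mult, (Rabs_pos_eq (/ 2)) by lra. lra.
  - unfold displacement, dot. rewrite lsum_filter, <- lsum_scal, <- lsum_minus.
    apply lsum_ext. intros k Hk. destruct (H1 k Hk) as [Hk1|Hk1]; rewrite Hk1;
      destruct (Rlt_dec 0 _); lra.
Qed.

Lemma permutation_filter_split {B} (p : B -> bool) l :
  Permutation l (filter p l ++ filter (fun b => negb (p b)) l).
Proof.
  induction l as [|b l IH]; simpl; [constructor|].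
  destruct (p b); simpl; [now constructor|].
  etransitivity; [constructor; exact IH|apply Permutation_middle].
Qed.

Lemma lsum_firstn_le {B} n (l : list B) f :
  (forall b, In b l -> 0 <= f b) -> lsum (firstn n l) f <= lsum l f.
Proof.
  intros H. rewrite <- (firstn_skipn n l) at 2. rewrite lsum_app.
  assert (0 <= lsum (skipn n l) f); [|lra]. apply lsum_nonneg.
  intros b Hb. apply H. rewrite <- (firstn_skipn n l). apply in_or_app. now right.
Qed.

(** Rounding the constant weight 1/2 splits the set into two halves, each with about half
of the sum for every form; the additional form with all coefficients 1 makes the halves
comparable in size.  The halves are ordered recursively.  A partial sum that ends in the
second half is bounded by the two half sums, which together exceed the full sum by
twice the rounding error only. *)
Lemma balanced_ordering (A : list nat) (rows : list (nat -> R)) :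
  NoDup A -> INR (length A) <= INR (length rows) + 1 ->
  (forall v k, In v rows -> In k A -> Rabs (v k) <= 1) ->
  exists l, Permutation A l /\ forall n v, In v rows ->
    Rabs (lsum (firstn n l) v) <=
      Rabs (lsum A v) + 1836 * root4_mul (INR (length rows) + 1) (INR (length A)).
Proof.
  remember (length A) as n eqn:Hn. revert A Hn.
  induction n as [n IH] using (well_founded_induction Nat.lt_wf_0).
  intros A Hn HA HN Hrow.
  set (N := INR (length rows) + 1) in *. set (E := root4_mul N (INR n)).
  pose proof (pos_INR n) as Hn0.
  assert (HE : 0 <= E) by apply root4_mul_pos.
  (* Below this size any order will do.  Above it the rounding error 54 E is at
     most n/4, and since 3/4 <= (47/50)^4 the bound 1836 E of each half is
     multiplied by 47/50, which leaves room for the loss 108 E. *)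
  destruct (Rle_dec (INR n) (1836 * E)) as [Hsmall|Hbig].
  - exists A. split; [reflexivity|]. intros m v Hv.
    apply Rle_trans with (INR n); [|pose proof (Rabs_pos (lsum A v)); fold E; lra].
    eapply Rle_trans; [apply lsum_abs|].
    eapply Rle_trans; [apply lsum_firstn_le; intros; apply Rabs_pos|].
    rewrite Hn, <- (Rmult_1_r (INR _)), <- lsum_const. apply lsum_le. auto.
  - destruct (subset_rounding A ((fun _ => 1) :: rows) (fun _ => / 2)) as (b & Hb); auto.
    { simpl length. rewrite S_INR, <- Hn. exact HN. }
    { intros v k [<-|Hv] Hk; [rewrite Rabs_R1; lra|auto]. }
    { intros; lra. }
    simpl length in Hb. rewrite S_INR in Hb. fold N in Hb. rewrite <- Hn in Hb. fold E in Hb.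
    set (A0 := filter b A) in *. set (A1 := filter (fun k => negb (b k)) A).
    assert (Hlen : INR (length A0) + INR (length A1) = INR n).
    { rewrite Hn. apply length_filter_split. }
    assert (Hsize : Rabs (INR (length A0) - INR n / 2) <= 54 * E).
    { specialize (Hb _ (or_introl eq_refl)). rewrite !lsum_const in Hb.
      rewrite Hn. replace (INR (length A) / 2) with (INR (length A) * (/ 2 * 1)) by field.
      rewrite <- (Rmult_1_r (INR (length A0))). exact Hb. }
    apply Rabs_le_between in Hsize.
    assert (Hsub : forall A', (A' = A0 \/ A' = A1) ->
      exists l, Permutation A' l /\ forall m v, In v rows ->
        Rabs (lsum (firstn m l) v) <= Rabs (lsum A' v) + 1836 * (47 / 50 * E)).
    { intros A' HA'.
      assert (Hl : INR (length A') <= 3 / 4 * INR n) by (destruct HA' as [-> | ->]; lra).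
      assert (Hin : forall k, In k A' -> In k A).
      { intros k Hk. destruct HA' as [-> | ->]; apply filter_In in Hk; tauto. }
      destruct (IH (length A')) with (A := A') as (l & Hp & Hl'); auto.
      - apply INR_lt. lra.
      - destruct HA' as [-> | ->]; now apply NoDup_filter.
      - lra.
      - exists l. split; [exact Hp|]. intros m v Hv.
        eapply Rle_trans; [apply Hl'; exact Hv|]. fold N.
        assert (root4_mul N (INR (length A')) <= 47 / 50 * E); [|lra].
        apply root4_mul_shrink; try lra; apply pos_INR. }
    destruct (Hsub A0 (or_introl eq_refl)) as (l0 & Hp0 & H0).
    destruct (Hsub A1 (or_intror eq_refl)) as (l1 & Hp1 & H1).
    exists (l0 ++ l1). split.
    { etransitivity; [apply (permutation_filter_split b)|]. now apply Permutation_app. }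
    intros m v Hv. fold E.
    assert (Hb0 : Rabs (lsum A0 v - / 2 * lsum A v) <= 54 * E).
    { rewrite <- lsum_scal. apply Hb. now right. }
    assert (Hs : lsum A v = lsum A0 v + lsum A1 v) by apply lsum_filter_split.
    assert (Hsum : Rabs (lsum A0 v) + Rabs (lsum A1 v) <= Rabs (lsum A v) + 108 * E).
    { assert (Rabs (lsum A0 v) <= Rabs (lsum A v) / 2 + 54 * E).
      { replace (lsum A0 v) with (/ 2 * lsum A v + (lsum A0 v - / 2 * lsum A v)) by ring.
        eapply Rle_trans; [apply Rabs_triang|].
        rewrite Rabs_mult, (Rabs_pos_eq (/ 2)) by lra. lra. }
      assert (Rabs (lsum A1 v) <= Rabs (lsum A v) / 2 + 54 * E); [|lra].
      replace (lsum A1 v) with (/ 2 * lsum A v + - (lsum A0 v - / 2 * lsum A v)) by lra.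
      eapply Rle_trans; [apply Rabs_triang|].
      rewrite Rabs_mult, (Rabs_pos_eq (/ 2)), Rabs_Ropp by lra. lra. }
    rewrite firstn_app, lsum_app.
    destruct (Nat.le_gt_cases m (length l0)) as [Hm|Hm].
    + replace (m - length l0)%nat with 0%nat by lia. simpl. rewrite Rplus_0_r.
      specialize (H0 m v Hv). pose proof (Rabs_pos (lsum A1 v)). lra.
    + rewrite firstn_all2 by lia. rewrite <- (lsum_perm _ _ v Hp0).
      eapply Rle_trans; [apply Rabs_triang|]. specialize (H1 (m - length l0)%nat v Hv). lra.
Qed.

(** * Fejer kernels and sampling of trigonometric polynomials *)

(** The weight vanishes at [k = N], so the degree is at most [N - 1]. *)
Definition fejer (N : nat) (u : R) : R :=
  1 + 2 * lsum (seq 1 N) (fun k => (1 - INR k / INR N) * cos (INR k * u)).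

Lemma lsum_seq_rev N (h : nat -> R) :
  lsum (seq 0 N) (fun j => h (N - j)%nat) = lsum (seq 1 N) h.
Proof.
  induction N as [|N IH]; [reflexivity|].
  rewrite (seq_S N 1), lsum_app, <- IH. simpl seq. rewrite <- seq_shift.
  cbn [lsum]. rewrite lsum_map. cbn [Nat.sub Nat.add]. rewrite Rplus_0_r. ring.
Qed.

(** This is the squared modulus of a Dirichlet sum, hence nonnegative. *)
Lemma fejer_square N u :
  lsum (seq 0 N) (fun j => cos (INR j * u)) ^ 2 +
  lsum (seq 0 N) (fun j => sin (INR j * u)) ^ 2 =
  INR N + 2 * lsum (seq 1 N) (fun k => (INR N - INR k) * cos (INR k * u)).
Proof.
  induction N as [|N IH]; [simpl; ring|].
  rewrite !(seq_S N), !lsum_app, S_INR. cbn [lsum Nat.add]. rewrite !Rplus_0_r.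
  set (c := lsum (seq 0 N) (fun j => cos (INR j * u))) in *.
  set (s := lsum (seq 0 N) (fun j => sin (INR j * u))) in *.
  assert (Hx : c * cos (INR N * u) + s * sin (INR N * u) =
               lsum (seq 1 N) (fun k => cos (INR k * u))).
  { rewrite <- lsum_seq_rev. unfold c, s.
    rewrite (Rmult_comm (lsum _ _)), (Rmult_comm (lsum (seq 0 N) _) (sin _)),
      <- !lsum_scal, <- lsum_plus.
    apply lsum_ext. intros j Hj. apply in_seq in Hj.
    rewrite minus_INR by lia. rewrite Rmult_minus_distr_r, cos_minus. ring. }
  rewrite (lsum_ext (seq 1 N) (fun k => (INR N + 1 - INR k) * cos (INR k * u))
     (fun k => (INR N - INR k) * cos (INR k * u) + cos (INR k * u))) by (intros; ring).
  rewrite lsum_plus, <- Hx. rewrite (S_INR N).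
  assert (Hsc := sin2_cos2 (INR N * u)). unfold Rsqr in Hsc. nra.
Qed.

Lemma fejer_nonneg N u : (1 <= N)%nat -> 0 <= fejer N u.
Proof.
  intros HN. assert (Hp : 0 < INR N) by (apply lt_0_INR; lia).
  apply Rmult_le_reg_l with (INR N); [exact Hp|]. rewrite Rmult_0_r.
  replace (INR N * fejer N u) with
    (lsum (seq 0 N) (fun j => cos (INR j * u)) ^ 2 +
     lsum (seq 0 N) (fun j => sin (INR j * u)) ^ 2).
  - pose proof (pow2_ge_0 (lsum (seq 0 N) (fun j => cos (INR j * u)))).
    pose proof (pow2_ge_0 (lsum (seq 0 N) (fun j => sin (INR j * u)))). lra.
  - rewrite fejer_square. unfold fejer.
    replace (INR N * (1 + 2 * lsum (seq 1 N) (fun k => (1 - INR k / INR N) * cos (INR k * u))))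
      with (INR N + 2 * (INR N * lsum (seq 1 N) (fun k => (1 - INR k / INR N) * cos (INR k * u))))
      by ring.
    rewrite <- (lsum_scal _ (INR N)). do 2 f_equal. apply lsum_ext. intros. field. lra.
Qed.

(** Trigonometric polynomials of degree at most [d] without constant term.  The mean over
the circle and, if [d < M], the mean over [M] equally spaced points both annihilate them;
the reproducing identities below thus hold for the integral and for the sampling sum
at once. *)
Definition oscillating (d : nat) (h : R -> R) : Prop :=
  exists q : list (R * nat * R),
    (forall c m psi, In (c, m, psi) q -> (1 <= m <= d)%nat) /\
    forall t, h t = lsum q (fun p => let '(c, m, psi) := p in c * cos (INR m * t + psi)).

Lemma oscillating_ext d h h' :
  (forall t, h t = h' t) -> oscillating d h -> oscillating d h'.
Proof. intros He (q & Hq & H). exists q. split; [exact Hq|]. intros t. now rewrite <- He. Qed.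

Lemma oscillating_cos d m c psi :
  (1 <= m <= d)%nat -> oscillating d (fun t => c * cos (INR m * t + psi)).
Proof.
  intros Hm. exists [(c, m, psi)]. split.
  - intros c' m' psi' [H|[]]. injection H; intros; subst; assumption.
  - intros t. simpl. ring.
Qed.

Lemma oscillating_plus d h1 h2 :
  oscillating d h1 -> oscillating d h2 -> oscillating d (fun t => h1 t + h2 t).
Proof.
  intros (q1 & Hq1 & H1) (q2 & Hq2 & H2). exists (q1 ++ q2). split.
  - intros c m psi H. apply in_app_or in H. destruct H; eauto.
  - intros t. now rewrite lsum_app, H1, H2.
Qed.

Lemma oscillating_scal d c h : oscillating d h -> oscillating d (fun t => c * h t).
Proof.
  intros (q & Hq & H). exists (map (fun p => let '(c0, m, psi) := p in (c * c0, m, psi)) q).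
  split.
  - intros c' m psi Hin. apply in_map_iff in Hin.
    destruct Hin as ([[c0 m0] p0] & He & Hin). injection He; intros; subst. eauto.
  - intros t. rewrite lsum_map, H, <- lsum_scal. apply lsum_ext.
    intros [[c0 m0] p0] _. ring.
Qed.

Lemma oscillating_lsum {B} d (l : list B) (h : B -> R -> R) :
  (forall b, In b l -> oscillating d (h b)) -> oscillating d (fun t => lsum l (fun b => h b t)).
Proof.
  induction l as [|b l IH]; intros H; simpl.
  - exists nil. split; [easy|reflexivity].
  - apply oscillating_plus; [apply H; now left|]. apply IH. intros; apply H; now right.
Qed.

Lemma fejer_minus_one N x : oscillating N (fun t => fejer N (x - t) - 1).
Proof.
  apply oscillating_ext with (fun t => lsum (seq 1 N) (fun k =>
    2 * (1 - INR k / INR N) * cos (INR k * t + - (INR k * x)))).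
  - intros t. unfold fejer. rewrite Rplus_minus_l, <- lsum_scal.
    apply lsum_ext. intros k _.
    replace (INR k * t + - (INR k * x)) with (- (INR k * (x - t))) by ring.
    rewrite cos_neg. ring.
  - apply oscillating_lsum. intros k Hk. apply in_seq in Hk. apply oscillating_cos. lia.
Qed.

Lemma two_cos_cos a b : 2 * (cos a * cos b) = cos (a + b) + cos (a - b).
Proof. rewrite cos_plus, cos_minus. ring. Qed.

(** Only the product of the harmonics of equal frequency has a constant term. *)
Lemma fejer_reproduces N k x phi : (1 <= k <= N)%nat ->
  oscillating (k + N) (fun t =>
    cos (INR k * t + phi) * fejer N (x - t) - (1 - INR k / INR N) * cos (INR k * x + phi)).
Proof.
  intros Hk.
  set (w := fun l => 1 - INR l / INR N).
  apply oscillating_ext with (fun t => 1 * cos (INR k * t + phi) +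
    lsum (seq 1 N) (fun l => w l * (cos (INR (k + l) * t + (phi - INR l * x)) +
       (cos ((INR k - INR l) * t + (phi + INR l * x)) -
        cos (INR k * x + phi) * basis_vec k l)))).
  - intros t.
    transitivity (1 * cos (INR k * t + phi) +
      lsum (seq 1 N) (fun l => cos (INR k * t + phi) * (2 * (w l * cos (INR l * (x - t)))) -
        cos (INR k * x + phi) * (w l * basis_vec k l))).
    + f_equal. apply lsum_ext. intros l _.
      assert (H := two_cos_cos (INR k * t + phi) (INR l * (x - t))).
      replace (INR k * t + phi + INR l * (x - t))
        with ((INR k - INR l) * t + (phi + INR l * x)) in H by ring.
      replace (INR k * t + phi - INR l * (x - t))
        with (INR (k + l) * t + (phi - INR l * x)) in H by (rewrite plus_INR; ring).
      replace (cos (INR k * t + phi) * (2 * (w l * cos (INR l * (x - t)))))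
        with (w l * (2 * (cos (INR k * t + phi) * cos (INR l * (x - t))))) by ring.
      rewrite H. ring.
    + rewrite lsum_minus, !lsum_scal.
      change (lsum (seq 1 N) (fun a => w a * basis_vec k a)) with (dot (seq 1 N) w (basis_vec k)).
      rewrite dot_basis; [|apply seq_NoDup|apply in_seq; lia].
      unfold fejer, w. ring.
  - apply oscillating_plus; [apply oscillating_cos; lia|].
    apply oscillating_lsum. intros l Hl. apply in_seq in Hl.
    apply oscillating_scal, oscillating_plus.
    + apply oscillating_ext with (fun t => 1 * cos (INR (k + l) * t + (phi - INR l * x)));
        [intros; ring|apply oscillating_cos; lia].
    + unfold basis_vec. destruct (Nat.eq_dec l k) as [->|Hne].
      * exists nil. split; [easy|]. intros t. simpl.
        replace ((INR k - INR k) * t + (phi + INR k * x)) with (INR k * x + phi) by ring. ring.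
      * destruct (Nat.lt_ge_cases l k) as [Hlt|Hge].
        -- apply oscillating_ext with (fun t => 1 * cos (INR (k - l) * t + (phi + INR l * x)));
             [intros; rewrite minus_INR by lia; ring|apply oscillating_cos; lia].
        -- apply oscillating_ext with (fun t => 1 * cos (INR (l - k) * t + - (phi + INR l * x)));
             [intros t; rewrite minus_INR by lia|apply oscillating_cos; lia].
           replace ((INR l - INR k) * t + - (phi + INR l * x))
             with (- ((INR k - INR l) * t + (phi + INR l * x))) by ring.
           rewrite cos_neg. ring.
Qed.

Definition grid_point (M j : nat) : R := INR j * (2 * PI / INR M).

Lemma cos_progression_sum M alpha psi :
  2 * sin (alpha / 2) * lsum (seq 0 M) (fun j => cos (INR j * alpha + psi)) =
  sin (INR M * alpha + (psi - alpha / 2)) - sin (psi - alpha / 2).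
Proof.
  induction M as [|M IH].
  - simpl. rewrite Rmult_0_l, Rplus_0_l. ring.
  - rewrite seq_S, lsum_app, Rmult_plus_distr_l, IH. cbn [lsum Nat.add].
    replace (INR (S M) * alpha + (psi - alpha / 2))
      with (INR M * alpha + psi + alpha / 2) by (rewrite S_INR; field).
    replace (INR M * alpha + (psi - alpha / 2))
      with (INR M * alpha + psi - alpha / 2) by ring.
    rewrite sin_plus, sin_minus. ring.
Qed.

Lemma grid_cos_sum M m psi : (1 <= m < M)%nat ->
  lsum (seq 0 M) (fun j => cos (INR m * grid_point M j + psi)) = 0.
Proof.
  intros Hm. set (alpha := INR m * (2 * PI / INR M)).
  assert (HM : 0 < INR M) by (apply lt_0_INR; lia).
  assert (Hm0 : 0 < INR m) by (apply lt_0_INR; lia).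
  assert (HmM : INR m < INR M) by (apply lt_INR; lia).
  pose proof PI_RGT_0 as Hpi.
  rewrite (lsum_ext _ _ (fun j => cos (INR j * alpha + psi)))
    by (intros; unfold grid_point, alpha; f_equal; ring).
  assert (H := cos_progression_sum M alpha psi).
  replace (INR M * alpha + (psi - alpha / 2))
    with ((psi - alpha / 2) + 2 * INR m * PI) in H by (unfold alpha; field; lra).
  rewrite sin_period, Rminus_diag in H.
  assert (Hs : 0 < sin (alpha / 2)).
  { apply sin_gt_0.
    - unfold alpha. apply Rmult_lt_0_compat; [|lra].
      apply Rmult_lt_0_compat; [exact Hm0|]. apply Rdiv_lt_0_compat; lra.
    - apply Rmult_lt_reg_r with (INR M); [exact HM|].
      replace (alpha / 2 * INR M) with (INR m * PI) by (unfold alpha; field; lra). nra. }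
  apply Rmult_integral in H. destruct H; lra.
Qed.

Lemma grid_oscillating_sum M d h : oscillating d h -> (d < M)%nat ->
  lsum (seq 0 M) (fun j => h (grid_point M j)) = 0.
Proof.
  intros (q & Hq & H) Hd.
  rewrite (lsum_ext _ _ (fun j => lsum q (fun p => let '(c, m, psi) := p in
     c * cos (INR m * grid_point M j + psi)))) by (intros; apply H).
  rewrite lsum_swap. apply lsum_0. intros [[c m] psi] Hin.
  rewrite lsum_scal, grid_cos_sum; [ring|]. specialize (Hq _ _ _ Hin). lia.
Qed.

(** The kernel [2 F_(2n) - F_n] reproduces polynomials of degree at most [n], and the
sampling formula is exact on [4n] points because the products have degree at most [3n].
The two kernels being nonnegative with mean 1, the absolute values of the combined kernel
have mean at most [2 + 1 = 3]. *)
Lemma grid_sup_bound n (l : list nat) (c phi : nat -> R) K :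
  (1 <= n)%nat -> (forall k, In k l -> (1 <= k <= n)%nat) ->
  (forall j, (j < 4 * n)%nat ->
     Rabs (lsum l (fun k => c k * cos (INR k * grid_point (4 * n) j + phi k))) <= K) ->
  forall x, Rabs (lsum l (fun k => c k * cos (INR k * x + phi k))) <= 3 * K.
Proof.
  intros Hn Hl HK x. set (M := (4 * n)%nat) in *.
  set (P := fun x => lsum l (fun k => c k * cos (INR k * x + phi k))) in *.
  change (Rabs (P x) <= 3 * K).
  assert (HM : 0 < INR M) by (apply lt_0_INR; unfold M; lia).
  assert (Hn0 : 0 < INR n) by (apply lt_0_INR; lia).
  set (V := fun j => 2 * fejer (2 * n) (x - grid_point M j) - fejer n (x - grid_point M j)).
  assert (Hmass : forall N, (1 <= N <= 2 * n)%nat ->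
    lsum (seq 0 M) (fun j => fejer N (x - grid_point M j)) = INR M).
  { intros N HN. assert (H := grid_oscillating_sum M N _ (fejer_minus_one N x) ltac:(unfold M; lia)).
    cbv beta in H. rewrite lsum_minus, lsum_const, length_seq in H. lra. }
  assert (Hterm : forall N k, (1 <= k <= n)%nat -> (n <= N <= 2 * n)%nat ->
    lsum (seq 0 M) (fun j => cos (INR k * grid_point M j + phi k) * fejer N (x - grid_point M j))
    = INR M * ((1 - INR k / INR N) * cos (INR k * x + phi k))).
  { intros N k Hk HN.
    assert (H := grid_oscillating_sum M (k + N) _ (fejer_reproduces N k x (phi k) ltac:(lia))
       ltac:(unfold M; lia)).
    cbv beta in H. rewrite lsum_minus, lsum_const, length_seq in H. lra. }
  assert (Hrep : INR M * P x = lsum (seq 0 M) (fun j => P (grid_point M j) * V j)).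
  { unfold P.
    rewrite (lsum_ext (seq 0 M) _ (fun j => lsum l (fun k => c k *
      (2 * (cos (INR k * grid_point M j + phi k) * fejer (2 * n) (x - grid_point M j)) -
       cos (INR k * grid_point M j + phi k) * fejer n (x - grid_point M j))))).
    - rewrite lsum_swap, <- lsum_scal. apply lsum_ext. intros k Hk.
      rewrite lsum_scal, lsum_minus, lsum_scal, !Hterm by (auto; lia).
      rewrite mult_INR. simpl (INR 2). field. lra.
    - intros j _. unfold V. rewrite Rmult_comm, <- lsum_scal. apply lsum_ext. intros; ring. }
  apply Rmult_le_reg_l with (INR M); [exact HM|].
  rewrite <- (Rabs_pos_eq (INR M)) at 1 by lra. rewrite <- Rabs_mult, Hrep.
  eapply Rle_trans; [apply lsum_abs|].
  apply Rle_trans with (lsum (seq 0 M) (fun j => K *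
    (2 * fejer (2 * n) (x - grid_point M j) + fejer n (x - grid_point M j)))).
  - apply lsum_le. intros j Hj. apply in_seq in Hj. rewrite Rabs_mult.
    apply Rmult_le_compat; try apply Rabs_pos; [apply HK; lia|]. unfold V.
    assert (H1 := fejer_nonneg (2 * n) (x - grid_point M j) ltac:(lia)).
    assert (H2 := fejer_nonneg n (x - grid_point M j) ltac:(lia)).
    apply Rabs_le_between. lra.
  - rewrite lsum_scal, lsum_plus, lsum_scal, !Hmass by lia. lra.
Qed.

(** * Integration over the circle *)

Definition cont (h : R -> R) : Prop := forall t, continuous h t.

Lemma cont_const c : cont (fun _ => c).
Proof. intros t. apply continuous_const. Qed.

Lemma cont_plus h1 h2 : cont h1 -> cont h2 -> cont (fun t => h1 t + h2 t).
Proof. intros H1 H2 t. now apply (continuous_plus h1 h2). Qed.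

Lemma cont_minus h1 h2 : cont h1 -> cont h2 -> cont (fun t => h1 t - h2 t).
Proof. intros H1 H2 t. now apply (continuous_minus h1 h2). Qed.

Lemma cont_mult h1 h2 : cont h1 -> cont h2 -> cont (fun t => h1 t * h2 t).
Proof. intros H1 H2 t. now apply (continuous_mult h1 h2). Qed.

Lemma cont_ext h h' : (forall t, h t = h' t) -> cont h -> cont h'.
Proof. intros He H t. apply (continuous_ext h); auto. Qed.

Lemma cont_cos a b : cont (fun t => cos (a * t + b)).
Proof.
  intros t. apply (continuous_comp (fun t => a * t + b) cos).
  - apply cont_plus; [apply cont_mult; [apply cont_const|intros u; apply continuous_id]|apply cont_const].
  - apply continuous_cos.
Qed.

Lemma cont_lsum {B} (l : list B) (h : B -> R -> R) :
  (forall b, In b l -> cont (h b)) -> cont (fun t => lsum l (fun b => h b t)).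
Proof.
  induction l as [|b l IH]; intros H; simpl; [apply cont_const|].
  apply (cont_plus (h b)); [apply H; now left|]. apply IH; intros; apply H; now right.
Qed.

Lemma cont_fejer N x : cont (fun t => fejer N (x - t)).
Proof.
  apply cont_plus; [apply cont_const|]. apply cont_mult; [apply cont_const|].
  apply cont_lsum. intros k _. apply cont_mult; [apply cont_const|].
  apply cont_ext with (fun t => cos (- INR k * t + INR k * x)); [|apply cont_cos].
  intros; f_equal; ring.
Qed.

Definition circle_int (h : R -> R) : R := RInt h 0 (2 * PI).

Lemma cont_ex_RInt h a b : cont h -> ex_RInt h a b.
Proof. intros H. apply (ex_RInt_continuous (V := R_CompleteNormedModule)). auto. Qed.

Lemma circle_int_ext h h' : (forall t, h t = h' t) -> circle_int h = circle_int h'.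
Proof. intros H. apply RInt_ext. auto. Qed.

Lemma circle_int_plus h1 h2 : cont h1 -> cont h2 ->
  circle_int (fun t => h1 t + h2 t) = circle_int h1 + circle_int h2.
Proof. intros H1 H2. apply (RInt_plus h1 h2); now apply cont_ex_RInt. Qed.

Lemma circle_int_scal c h : cont h -> circle_int (fun t => c * h t) = c * circle_int h.
Proof. intros H. apply (RInt_scal h); now apply cont_ex_RInt. Qed.

Lemma circle_int_minus h1 h2 : cont h1 -> cont h2 ->
  circle_int (fun t => h1 t - h2 t) = circle_int h1 - circle_int h2.
Proof. intros H1 H2. apply (RInt_minus h1 h2); now apply cont_ex_RInt. Qed.

Lemma circle_int_const c : circle_int (fun _ => c) = 2 * PI * c.
Proof. unfold circle_int. rewrite RInt_const. unfold scal; simpl. unfold mult; simpl. ring. Qed.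

Lemma circle_int_le h1 h2 : cont h1 -> cont h2 -> (forall t, h1 t <= h2 t) ->
  circle_int h1 <= circle_int h2.
Proof.
  intros H1 H2 H. apply RInt_le; try now apply cont_ex_RInt.
  - pose proof PI_RGT_0. lra.
  - auto.
Qed.

Lemma circle_int_lsum {B} (l : list B) (h : B -> R -> R) :
  (forall b, In b l -> cont (h b)) ->
  circle_int (fun t => lsum l (fun b => h b t)) = lsum l (fun b => circle_int (h b)).
Proof.
  induction l as [|b l IH]; intros H; simpl.
  - rewrite circle_int_const. ring.
  - rewrite (circle_int_plus (h b)).
    + rewrite IH; [reflexivity|]. intros; apply H; now right.
    + apply H; now left.
    + apply cont_lsum. intros; apply H; now right.
Qed.

Lemma circle_int_abs h b : cont h -> cont b -> (forall t, Rabs (h t) <= b t) ->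
  Rabs (circle_int h) <= circle_int b.
Proof.
  intros Hh Hb H. apply Rabs_le_between. split.
  - replace (- circle_int b) with (circle_int (fun t => -1 * b t))
      by (rewrite circle_int_scal by assumption; ring).
    apply circle_int_le; auto.
    + apply cont_mult; [apply cont_const|auto].
    + intros t. specialize (H t). apply Rabs_le_between in H. lra.
  - apply circle_int_le; auto. intros t. specialize (H t). apply Rabs_le_between in H. lra.
Qed.

Lemma circle_int_cos m psi : (1 <= m)%nat -> circle_int (fun t => cos (INR m * t + psi)) = 0.
Proof.
  intros Hm. assert (Hp : 0 < INR m) by (apply lt_0_INR; lia).
  apply is_RInt_unique.
  replace 0 with (minus (/ INR m * sin (INR m * (2 * PI) + psi)) (/ INR m * sin (INR m * 0 + psi))) at 2.
  - apply (is_RInt_derive (fun t => / INR m * sin (INR m * t + psi))).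
    + intros t _. auto_derive; [exact I|]. field. lra.
    + intros t _. apply cont_cos.
  - replace (INR m * (2 * PI) + psi) with (psi + 2 * INR m * PI) by ring.
    rewrite sin_period, Rmult_0_r, Rplus_0_l. apply (minus_eq_zero (G := R_AbelianGroup)).
Qed.

Lemma circle_int_oscillating d h : oscillating d h -> circle_int h = 0.
Proof.
  intros (q & Hq & H). rewrite (circle_int_ext _ _ H).
  rewrite (circle_int_lsum q (fun p t => let '(c, m, psi) := p in c * cos (INR m * t + psi))).
  - apply lsum_0. intros [[c m] psi] Hin. rewrite circle_int_scal by apply cont_cos.
    rewrite circle_int_cos; [ring|]. specialize (Hq _ _ _ Hin). lia.
  - intros [[c m] psi] _. apply cont_mult; [apply cont_const|apply cont_cos].
Qed.

Lemma circle_int_fejer N x : circle_int (fun t => fejer N (x - t)) = 2 * PI.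
Proof.
  assert (H := circle_int_oscillating _ _ (fejer_minus_one N x)).
  rewrite (circle_int_minus (fun t => fejer N (x - t)) (fun _ => 1)) in H
    by (apply cont_fejer || apply cont_const).
  rewrite circle_int_const in H. lra.
Qed.

Lemma circle_int_fejer_cos N x : (1 <= N)%nat ->
  circle_int (fun t => cos (x - t) * fejer N (x - t)) = 2 * PI * (1 - / INR N).
Proof.
  intros HN. assert (HN0 : 0 < INR N) by (apply lt_0_INR; lia).
  assert (H := circle_int_oscillating _ _ (fejer_reproduces N 1 x (- x) ltac:(lia))).
  rewrite (circle_int_minus (fun t => cos (INR 1 * t + - x) * fejer N (x - t)) (fun _ => _)) in H.
  - rewrite circle_int_const in H.
    rewrite (circle_int_ext _ (fun t => cos (INR 1 * t + - x) * fejer N (x - t))).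
    + replace (INR 1 * x + - x) with 0 in H by (simpl; ring).
      rewrite cos_0 in H. replace (1 - / INR N) with ((1 - INR 1 / INR N) * 1) by (simpl; field; lra).
      lra.
    + intros t. f_equal. rewrite <- cos_neg. f_equal. simpl. ring.
  - apply cont_mult; [apply cont_cos|apply cont_fejer].
  - apply cont_const.
Qed.

Lemma periodic_shift (g : R -> R) : (forall x, g (x + 2 * PI) = g x) ->
  forall (k : Z) x, g (x + IZR k * (2 * PI)) = g x.
Proof.
  intros Hp k x. pose (gc := fun t => (g t, 0) : C).
  assert (H := periodic_Z gc (fun t => f_equal (fun r => (r, 0)) (Hp t)) k x).
  exact (f_equal fst H).
Qed.

Lemma periodic_reduce x c : exists k : Z, c <= x + IZR k * (2 * PI) <= c + 2 * PI.
Proof.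
  pose proof PI_RGT_0 as Hpi.
  set (y := (x - c) / (2 * PI)).
  exists (- Int_part y)%Z. destruct (base_Int_part y) as [H1 H2]. rewrite opp_IZR.
  replace x with (c + y * (2 * PI)) by (unfold y; field; lra). split; nra.
Qed.

Lemma periodic_bounded g : cont g -> (forall x, g (x + 2 * PI) = g x) ->
  exists B, 0 <= B /\ forall x, Rabs (g x) <= B.
Proof.
  intros Hc Hp. pose proof PI_RGT_0 as Hpi.
  destruct (continuity_ab_maj (fun t => Rabs (g t)) 0 (2 * PI)) as [M [HM _]]; [lra| |].
  - intros t _. apply continuity_pt_filterlim.
    apply (continuous_comp g Rabs); [apply Hc|apply continuous_Rabs].
  - exists (Rabs (g M)). split; [apply Rabs_pos|]. intros x.
    destruct (periodic_reduce x 0) as [k Hk].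
    rewrite <- (periodic_shift g Hp k x). apply HM. lra.
Qed.

(** Close points of the circle are handled by uniform continuity; for the others
[1 - cos (x - t)] is bounded away from 0.  With this bound the convergence of a positive
summation method needs to be tested on the function [cos] only. *)
Lemma korovkin_bound g eps : cont g -> (forall x, g (x + 2 * PI) = g x) -> 0 < eps ->
  exists K, 0 <= K /\ forall x t, Rabs (g t - g x) <= eps + K * (1 - cos (x - t)).
Proof.
  intros Hc Hp He. pose proof PI_RGT_0 as Hpi.
  destruct (periodic_bounded g Hc Hp) as (B & HB & HgB).
  destruct (Heine_cor2 (f := g) (a := - 4 * PI) (b := 4 * PI)) with (eps := mkposreal eps He)
    as [del Hdel].
  { intros t _. apply continuity_pt_filterlim, Hc. }
  set (dd := Rmin (del / 2) PI).
  assert (Hd : 0 < dd) by (apply Rmin_pos; [pose proof (cond_pos del); lra|lra]).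
  assert (Hd1 : dd < del) by (pose proof (cond_pos del); pose proof (Rmin_l (del / 2) PI); unfold dd in *; lra).
  assert (Hd2 : dd <= PI) by apply Rmin_r.
  assert (Hcd : cos dd < 1) by (rewrite <- cos_0; apply cos_decreasing_1; lra).
  exists (2 * B / (1 - cos dd)). split; [apply Rmult_le_pos; [lra|left; apply Rinv_0_lt_compat; lra]|].
  intros x t.
  assert (HK : 0 <= 2 * B / (1 - cos dd)) by (apply Rmult_le_pos; [lra|left; apply Rinv_0_lt_compat; lra]).
  destruct (periodic_reduce x 0) as [i Hi]. set (x1 := x + IZR i * (2 * PI)) in *.
  destruct (periodic_reduce t (x1 - PI)) as [k Hk]. set (t1 := t + IZR k * (2 * PI)) in *.
  assert (Hgx : g x = g x1) by (symmetry; apply periodic_shift, Hp).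
  assert (Hgt : g t = g t1) by (symmetry; apply periodic_shift, Hp).
  assert (Hcos : cos (x - t) = cos (x1 - t1)).
  { unfold x1, t1. rewrite <- (periodic_shift cos) with (k := (i - k)%Z) (x := x - t).
    - f_equal. rewrite minus_IZR. ring.
    - intros y. rewrite <- (cos_period y 1). f_equal. simpl. ring. }
  rewrite Hgx, Hgt, Hcos. pose proof (COS_bound (x1 - t1)) as Hb.
  destruct (Rlt_dec (Rabs (t1 - x1)) dd) as [Hlt|Hge].
  - assert (Rabs (g t1 - g x1) < eps).
    { apply Hdel; try lra. }
    assert (0 <= 2 * B / (1 - cos dd) * (1 - cos (x1 - t1))) by (apply Rmult_le_pos; lra). lra.
  - assert (Hcle : cos (x1 - t1) <= cos dd).
    { replace (cos (x1 - t1)) with (cos (Rabs (t1 - x1))).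
      - assert (Rabs (t1 - x1) <= PI) by (apply Rabs_le_between; lra). apply cos_decr_1; lra.
      - unfold Rabs. destruct (Rcase_abs (t1 - x1)); [f_equal; ring|].
        rewrite <- cos_neg. f_equal; ring. }
    apply Rle_trans with (2 * B).
    + unfold Rminus. eapply Rle_trans; [apply Rabs_triang|]. rewrite Rabs_Ropp.
      pose proof (HgB t1). pose proof (HgB x1). lra.
    + assert (2 * B / (1 - cos dd) * (1 - cos dd) <= 2 * B / (1 - cos dd) * (1 - cos (x1 - t1)))
        by (apply Rmult_le_compat_l; lra).
      replace (2 * B / (1 - cos dd) * (1 - cos dd)) with (2 * B) in H by (field; lra). lra.
Qed.

(** * Fejer means, square summability, passage to real components *)

(** The Fourier coefficients of the real function [g] in amplitude and phase form. *)
Definition fourier_cos_form (g : R -> R) (D phi : nat -> R) : Prop :=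
  D 0%nat = / (2 * PI) * circle_int g /\
  forall k x, (1 <= k)%nat ->
    D k * cos (INR k * x + phi k) = / PI * circle_int (fun t => g t * cos (INR k * (x - t))).

Definition fejer_mean (D phi : nat -> R) (N : nat) (x : R) : R :=
  D 0%nat + lsum (seq 1 N) (fun k => (1 - INR k / INR N) * (D k * cos (INR k * x + phi k))).

Lemma cont_cos_shift k x : cont (fun t => cos (INR k * (x - t))).
Proof.
  apply cont_ext with (fun t => cos (- INR k * t + INR k * x)); [|apply cont_cos].
  intros; f_equal; ring.
Qed.

Lemma fejer_mean_integral g D phi N x : cont g -> fourier_cos_form g D phi ->
  fejer_mean D phi N x = / (2 * PI) * circle_int (fun t => g t * fejer N (x - t)).
Proof.
  intros Hg [H0 Hk]. pose proof PI_RGT_0 as Hpi. unfold fejer_mean, fejer.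
  rewrite (circle_int_ext _ (fun t => g t + lsum (seq 1 N) (fun k =>
     2 * (1 - INR k / INR N) * (g t * cos (INR k * (x - t)))))).
  - rewrite circle_int_plus, Rmult_plus_distr_l, <- H0.
    + f_equal.
      rewrite (circle_int_lsum (seq 1 N) (fun k t => 2 * (1 - INR k / INR N) * (g t * cos (INR k * (x - t))))).
      * rewrite <- lsum_scal. apply lsum_ext. intros k Hin. apply in_seq in Hin.
        rewrite circle_int_scal by (apply cont_mult; [exact Hg|apply cont_cos_shift]).
        rewrite Hk by lia. set (w := 1 - INR k / INR N). field. lra.
      * intros k _. apply cont_mult; [apply cont_const|].
        apply cont_mult; [exact Hg|apply cont_cos_shift].
    + exact Hg.
    + apply cont_lsum. intros k _. apply cont_mult; [apply cont_const|].
      apply cont_mult; [exact Hg|apply cont_cos_shift].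
  - intros t. rewrite Rmult_plus_distr_l, Rmult_1_r. f_equal.
    rewrite <- !lsum_scal. apply lsum_ext. intros; ring.
Qed.

(** Korovkin's argument: integrating the bound above against the nonnegative kernel gives
[eps + K / N], since the mean of [1 - cos] against the kernel is [1 / N]. *)
Lemma fejer_uniform g D phi eps : cont g -> (forall x, g (x + 2 * PI) = g x) ->
  fourier_cos_form g D phi -> 0 < eps ->
  exists N0, forall N, (N0 <= N)%nat -> forall x, Rabs (fejer_mean D phi N x - g x) <= eps.
Proof.
  intros Hg Hp HD He. pose proof PI_RGT_0 as Hpi.
  destruct (korovkin_bound g (eps / 2) Hg Hp) as (K & HK & Hbound); [lra|].
  destruct (INR_unbounded (2 * K / eps)) as [N0 HN0].
  exists (S N0). intros N HN x.
  assert (HN1 : 0 < INR N) by (apply lt_0_INR; lia).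
  assert (HKN : K / INR N <= eps / 2).
  { assert (H : INR N0 <= INR N) by (apply le_INR; lia).
    apply Rmult_le_reg_r with (INR N); [exact HN1|].
    replace (K / INR N * INR N) with K by (field; lra).
    apply Rmult_lt_compat_r with (r := eps) in HN0; [|exact He].
    replace (2 * K / eps * eps) with (2 * K) in HN0 by (field; lra). nra. }
  assert (Hdiff : fejer_mean D phi N x - g x =
    / (2 * PI) * circle_int (fun t => (g t - g x) * fejer N (x - t))).
  { rewrite (fejer_mean_integral g) by assumption.
    rewrite (circle_int_ext (fun t => (g t - g x) * fejer N (x - t))
      (fun t => g t * fejer N (x - t) - g x * fejer N (x - t))) by (intros; ring).
    rewrite circle_int_minus, circle_int_scal, circle_int_fejer.
    - field. lra.
    - apply cont_fejer.
    - apply cont_mult; [exact Hg|apply cont_fejer].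
    - apply cont_mult; [apply cont_const|apply cont_fejer]. }
  rewrite Hdiff, Rabs_mult, Rabs_pos_eq by (left; apply Rinv_0_lt_compat; lra).
  apply Rle_trans with (/ (2 * PI) * circle_int (fun t =>
     (eps / 2 + K) * fejer N (x - t) - K * (cos (x - t) * fejer N (x - t)))).
  - assert (Hc : cont (fun t => cos (x - t) * fejer N (x - t))).
    { apply cont_mult; [|apply cont_fejer].
      apply cont_ext with (fun t => cos (INR 1 * (x - t))); [|apply cont_cos_shift].
      intros; f_equal; simpl; ring. }
    apply Rmult_le_compat_l; [left; apply Rinv_0_lt_compat; lra|].
    apply circle_int_abs.
    + apply cont_mult; [|apply cont_fejer]. apply cont_minus; [exact Hg|apply cont_const].
    + apply cont_minus; apply cont_mult; try apply cont_const; [apply cont_fejer|exact Hc].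
    + intros t. assert (Hf := fejer_nonneg N (x - t) ltac:(lia)).
      rewrite Rabs_mult, (Rabs_pos_eq (fejer N (x - t))) by exact Hf.
      specialize (Hbound x t). nra.
  - rewrite circle_int_minus, !circle_int_scal, circle_int_fejer, circle_int_fejer_cos; [|lia| | | |].
    + replace (/ (2 * PI) * ((eps / 2 + K) * (2 * PI) - K * (2 * PI * (1 - / INR N))))
        with (eps / 2 + K / INR N) by (field; lra). lra.
    + apply cont_mult; [|apply cont_fejer].
      apply cont_ext with (fun t => cos (INR 1 * (x - t))); [|apply cont_cos_shift].
      intros; f_equal; simpl; ring.
    + apply cont_fejer.
    + apply cont_mult; [apply cont_const|apply cont_fejer].
    + apply cont_mult; [apply cont_const|]. apply cont_mult; [|apply cont_fejer].
      apply cont_ext with (fun t => cos (INR 1 * (x - t))); [|apply cont_cos_shift].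
      intros; f_equal; simpl; ring.
Qed.

(** Evaluation of the defining identity at the point where the harmonic equals 1. *)
Lemma coefficient_pairing g D phi k : fourier_cos_form g D phi -> (1 <= k)%nat ->
  circle_int (fun t => g t * cos (INR k * t + phi k)) = PI * D k.
Proof.
  intros [_ H] Hk. pose proof PI_RGT_0 as Hpi.
  assert (Hk0 : 0 < INR k) by (apply lt_0_INR; lia).
  specialize (H k (- phi k / INR k) Hk).
  replace (INR k * (- phi k / INR k) + phi k) with 0 in H by (field; lra).
  rewrite cos_0, Rmult_1_r in H. rewrite H, <- Rmult_assoc, Rinv_r, Rmult_1_l by lra.
  apply circle_int_ext. intros t. f_equal. rewrite <- cos_neg. f_equal. field. lra.
Qed.

(** The Fejer means are bounded by the supremum of [g], and pairing them with [g] gives the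
squares of the coefficients, those up to half the degree with weights at least 1/2. *)
Lemma coefficients_square_summable g D phi : cont g -> (forall x, g (x + 2 * PI) = g x) ->
  fourier_cos_form g D phi ->
  exists B, forall n, lsum (seq 1 n) (fun k => D k ^ 2) <= B.
Proof.
  intros Hg Hp HD. pose proof PI_RGT_0 as Hpi.
  destruct (periodic_bounded g Hg Hp) as (B & HB & HgB).
  exists (4 * B ^ 2). intros n.
  destruct (Nat.eq_dec n 0) as [->|Hn]; [simpl; nra|].
  set (N := (2 * n)%nat). assert (Hn0 : 0 < INR n) by (apply lt_0_INR; lia).
  assert (HN : INR N = 2 * INR n) by (unfold N; rewrite mult_INR; simpl; ring).
  assert (Hmean : forall x, Rabs (fejer_mean D phi N x) <= B).
  { intros x. rewrite (fejer_mean_integral g) by assumption.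
    rewrite Rabs_mult, Rabs_pos_eq by (left; apply Rinv_0_lt_compat; lra).
    apply Rle_trans with (/ (2 * PI) * circle_int (fun t => B * fejer N (x - t))).
    - apply Rmult_le_compat_l; [left; apply Rinv_0_lt_compat; lra|].
      apply circle_int_abs; [apply cont_mult; [exact Hg|apply cont_fejer]
                            |apply cont_mult; [apply cont_const|apply cont_fejer]|].
      intros t. assert (Hf := fejer_nonneg N (x - t) ltac:(lia)).
      rewrite Rabs_mult, (Rabs_pos_eq (fejer N (x - t))) by exact Hf.
      apply Rmult_le_compat_r; auto.
    - rewrite circle_int_scal, circle_int_fejer by apply cont_fejer. apply Req_le. field. lra. }
  assert (Hcm : cont (fejer_mean D phi N)).
  { apply cont_plus; [apply cont_const|]. apply cont_lsum. intros k _.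
    apply cont_mult; [apply cont_const|]. apply cont_mult; [apply cont_const|apply cont_cos]. }
  assert (Hpair : circle_int (fun t => g t * fejer_mean D phi N t) =
    2 * PI * D 0%nat ^ 2 + PI * lsum (seq 1 N) (fun k => (1 - INR k / INR N) * D k ^ 2)).
  { rewrite (circle_int_ext _ (fun t => D 0%nat * g t + lsum (seq 1 N) (fun k =>
      (1 - INR k / INR N) * D k * (g t * cos (INR k * t + phi k))))).
    - assert (Hc : forall k, cont (fun t => g t * cos (INR k * t + phi k)))
        by (intros; apply cont_mult; [exact Hg|apply cont_cos]).
      rewrite circle_int_plus, circle_int_scal.
      + rewrite (circle_int_lsum (seq 1 N) (fun k t =>
          (1 - INR k / INR N) * D k * (g t * cos (INR k * t + phi k)))).
        * f_equal.
          -- rewrite (proj1 HD). field. lra.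
          -- rewrite <- lsum_scal. apply lsum_ext. intros k Hk. apply in_seq in Hk.
             rewrite circle_int_scal by apply Hc.
             rewrite (coefficient_pairing g D phi k HD) by lia. ring.
        * intros k _. apply cont_mult; [apply cont_const|apply Hc].
      + exact Hg.
      + apply cont_mult; [apply cont_const|exact Hg].
      + apply cont_lsum. intros k _. apply cont_mult; [apply cont_const|apply Hc].
    - intros t. unfold fejer_mean. rewrite Rmult_plus_distr_l, <- lsum_scal. f_equal; [ring|].
      apply lsum_ext. intros; ring. }
  assert (Hup : circle_int (fun t => g t * fejer_mean D phi N t) <= 2 * PI * B ^ 2).
  { rewrite <- circle_int_const. eapply Rle_trans; [apply Rle_abs|].
    apply circle_int_abs; [now apply cont_mult|apply cont_const|].
    intros t. rewrite Rabs_mult. specialize (HgB t). specialize (Hmean t).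
    pose proof (Rabs_pos (g t)). pose proof (Rabs_pos (fejer_mean D phi N t)). nra. }
  assert (Hlow : lsum (seq 1 n) (fun k => D k ^ 2) <=
                 2 * lsum (seq 1 N) (fun k => (1 - INR k / INR N) * D k ^ 2)).
  { rewrite <- lsum_scal. unfold N at 1. replace (2 * n)%nat with (n + n)%nat by lia.
    rewrite seq_app, lsum_app.
    assert (Hfrac : forall k, (k <= N)%nat -> INR k / INR N <= 1).
    { intros k Hk. apply le_INR in Hk. apply Rmult_le_reg_r with (INR N); [lra|].
      replace (INR k / INR N * INR N) with (INR k) by (field; lra). lra. }
    assert (0 <= lsum (seq (1 + n) n) (fun a => 2 * ((1 - INR a / INR N) * D a ^ 2))).
    { apply lsum_nonneg. intros k Hk. apply in_seq in Hk.
      specialize (Hfrac k ltac:(unfold N; lia)). pose proof (pow2_ge_0 (D k)). nra. }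
    assert (lsum (seq 1 n) (fun k => D k ^ 2) <=
            lsum (seq 1 n) (fun a => 2 * ((1 - INR a / INR N) * D a ^ 2))); [|lra].
    apply lsum_le. intros k Hk. apply in_seq in Hk.
    assert (INR k / INR N <= 1 / 2).
    { assert (Hkn : INR k <= INR n) by (apply le_INR; lia).
      apply Rmult_le_reg_r with (INR N); [lra|].
      replace (INR k / INR N * INR N) with (INR k) by (field; lra). lra. }
    pose proof (pow2_ge_0 (D k)). nra. }
  set (W := lsum (seq 1 N) _) in *. pose proof (pow2_ge_0 (D 0%nat)). nra.
Qed.

Lemma RInt_circle_C (h : R -> C) :
  cont (fun t => fst (h t)) -> cont (fun t => snd (h t)) ->
  RInt (V := C_R_CompleteNormedModule) h 0 (2 * PI) =
  (circle_int (fun t => fst (h t)), circle_int (fun t => snd (h t))).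
Proof.
  intros H1 H2. apply is_RInt_unique.
  apply (is_RInt_fct_extend_pair (U := R_NormedModule) (V := R_NormedModule));
    apply (RInt_correct (V := R_CompleteNormedModule)); now apply cont_ex_RInt.
Qed.

Lemma cont_sin a : cont (fun t => sin (a * t)).
Proof.
  apply cont_ext with (fun t => cos (a * t + - (PI / 2))); [|apply cont_cos].
  intros t. rewrite <- (cos_neg (a * t + - (PI / 2))), <- cos_shift. f_equal. ring.
Qed.

Lemma cont_cos0 a : cont (fun t => cos (a * t)).
Proof.
  apply cont_ext with (fun t => cos (a * t + 0)); [|apply cont_cos]. intros; f_equal; ring.
Qed.

(** With [e^(-ikt)] split into cosine and sine, each component mixes the two components of [f]. *)
Lemma fourier_coeff_components (f : R -> C) k :
  cont (fun t => fst (f t)) -> cont (fun t => snd (f t)) ->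
  fourier_coeff f k =
  (/ (2 * PI) * (circle_int (fun t => fst (f t) * cos (IZR k * t))
                 + circle_int (fun t => snd (f t) * sin (IZR k * t))),
   / (2 * PI) * (circle_int (fun t => snd (f t) * cos (IZR k * t))
                 - circle_int (fun t => fst (f t) * sin (IZR k * t)))).
Proof.
  intros H1 H2.
  assert (C1 : forall h, cont h -> cont (fun t => h t * cos (IZR k * t)))
    by (intros h Hh; apply cont_mult; [exact Hh|apply cont_cos0]).
  assert (S1 : forall h, cont h -> cont (fun t => h t * sin (IZR k * t)))
    by (intros h Hh; apply cont_mult; [exact Hh|apply cont_sin]).
  assert (E1 : forall t, fst (f t * Cexp_i (- (IZR k * t)))%C =
    fst (f t) * cos (IZR k * t) + snd (f t) * sin (IZR k * t)).
  { intros t. simpl. rewrite cos_neg, sin_neg. ring. }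
  assert (E2 : forall t, snd (f t * Cexp_i (- (IZR k * t)))%C =
    snd (f t) * cos (IZR k * t) - fst (f t) * sin (IZR k * t)).
  { intros t. simpl. rewrite cos_neg, sin_neg. ring. }
  unfold fourier_coeff. rewrite RInt_circle_C.
  - rewrite (circle_int_ext _ _ E1), (circle_int_ext _ _ E2).
    rewrite circle_int_plus, circle_int_minus; auto.
    unfold Cmult, RtoC; simpl. f_equal; ring.
  - eapply cont_ext; [intros t; symmetry; apply E1|]. apply cont_plus; auto.
  - eapply cont_ext; [intros t; symmetry; apply E2|]. apply cont_minus; auto.
Qed.

Lemma circle_int_cos_sin h k x : cont h ->
  circle_int (fun t => h t * cos (INR k * (x - t))) =
  circle_int (fun t => h t * cos (INR k * t)) * cos (INR k * x) +
  circle_int (fun t => h t * sin (INR k * t)) * sin (INR k * x).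
Proof.
  intros Hh.
  assert (C1 : cont (fun t => h t * cos (INR k * t)))
    by (apply cont_mult; [exact Hh|apply cont_cos0]).
  assert (S1 : cont (fun t => h t * sin (INR k * t)))
    by (apply cont_mult; [exact Hh|apply cont_sin]).
  rewrite (circle_int_ext _ (fun t => cos (INR k * x) * (h t * cos (INR k * t)) +
     sin (INR k * x) * (h t * sin (INR k * t)))).
  - rewrite circle_int_plus, !circle_int_scal; auto; [ring| |];
      apply cont_mult; auto; apply cont_const.
  - intros t. rewrite Rmult_minus_distr_l, cos_minus. ring.
Qed.

(** The mixed terms cancel between the frequencies [k] and [-k], so the real and the imaginary
parts of [f] can be treated as two separate real functions. *)
Lemma fourier_term_components (f : R -> C) k x :
  cont (fun t => fst (f t)) -> cont (fun t => snd (f t)) -> (1 <= k)%nat ->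
  fourier_term f k x =
  (/ PI * circle_int (fun t => fst (f t) * cos (INR k * (x - t))),
   / PI * circle_int (fun t => snd (f t) * cos (INR k * (x - t)))).
Proof.
  intros H1 H2 Hk. pose proof PI_RGT_0 as Hpi.
  destruct k as [|k]; [lia|]. set (n := S k).
  change (fourier_term f n x) with
    ((fourier_coeff f (Z.of_nat n) * Cexp_i (INR n * x) +
      fourier_coeff f (- Z.of_nat n) * Cexp_i (- (INR n * x)))%C).
  clearbody n.
  rewrite !fourier_coeff_components, opp_IZR, <- INR_IZR_INZ by assumption.
  assert (Ec : forall h, circle_int (fun t => h t * cos (- INR n * t)) =
                         circle_int (fun t => h t * cos (INR n * t))).
  { intros h. apply circle_int_ext. intros t. rewrite <- cos_neg. do 2 f_equal. ring. }
  assert (Es : forall h, cont h -> circle_int (fun t => h t * sin (- INR n * t)) =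
                         - circle_int (fun t => h t * sin (INR n * t))).
  { intros h Hh. rewrite (circle_int_ext _ (fun t => -1 * (h t * sin (INR n * t)))).
    - rewrite circle_int_scal; [ring|]. apply cont_mult; [exact Hh|apply cont_sin].
    - intros t. replace (- INR n * t) with (- (INR n * t)) by ring. rewrite sin_neg. ring. }
  rewrite (Ec (fun t => fst (f t))), (Ec (fun t => snd (f t))),
    (Es (fun t => fst (f t)) H1), (Es (fun t => snd (f t)) H2).
  rewrite (circle_int_cos_sin (fun t => fst (f t))), (circle_int_cos_sin (fun t => snd (f t)))
    by assumption.
  unfold Cexp_i, Cplus, Cmult; simpl fst; simpl snd. rewrite cos_neg, sin_neg.
  f_equal; field; lra.
Qed.

(** * One dyadic block *)

Definition harmonic (D phi : nat -> R) (x : R) (k : nat) : R := D k * cos (INR k * x + phi k).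

(** The linear forms for the discrepancy lemmas: one for each grid point and each of the two
components, normalized to have coefficients at most 1. *)
Definition grid_rows (D : bool -> nat -> R) (phi : nat -> R) (delta : R) (M : nat)
  : list (nat -> R) :=
  flat_map (fun c => map (fun j k => / delta * harmonic (D c) phi (grid_point M j) k) (seq 0 M))
    [true; false].

Lemma length_grid_rows D phi delta M : length (grid_rows D phi delta M) = (2 * M)%nat.
Proof. unfold grid_rows. simpl. rewrite !length_app, !length_map, length_seq. simpl. lia. Qed.

Lemma in_grid_rows D phi delta M c j : (j < M)%nat ->
  In (fun k => / delta * harmonic (D c) phi (grid_point M j) k) (grid_rows D phi delta M).
Proof.
  intros Hj. apply in_flat_map. exists c. split; [destruct c; simpl; auto|].
  apply (in_map (fun j k => / delta * harmonic (D c) phi (grid_point M j) k)).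
  apply in_seq. lia.
Qed.

Lemma grid_rows_bound D phi delta M v k : 0 < delta ->
  (forall c, Rabs (D c k) <= delta) -> In v (grid_rows D phi delta M) -> Rabs (v k) <= 1.
Proof.
  intros Hd HD Hv. apply in_flat_map in Hv. destruct Hv as (c & _ & Hv).
  apply in_map_iff in Hv. destruct Hv as (j & <- & _). unfold harmonic.
  rewrite !Rabs_mult, (Rabs_pos_eq (/ delta)) by (left; now apply Rinv_0_lt_compat).
  apply Rle_trans with (/ delta * (delta * 1)).
  - apply Rmult_le_compat_l; [left; now apply Rinv_0_lt_compat|].
    apply Rmult_le_compat; try apply Rabs_pos; [apply HD|].
    apply Rabs_le_between. pose proof (COS_bound (INR k * grid_point M j + phi k)). lra.
  - apply Req_le. field. lra.
Qed.

Lemma root4_mul_le_sqrt N a r L : 0 <= N * a -> 0 <= r -> 0 <= L -> N * a <= r ^ 4 * L ^ 2 ->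
  root4_mul N a <= r * sqrt L.
Proof.
  intros H Hr HL Hle. apply root4_mul_le; [exact H| |].
  - apply Rmult_le_pos; [exact Hr|apply sqrt_pos].
  - replace ((r * sqrt L) ^ 4) with (r ^ 4 * (sqrt L * sqrt L) ^ 2) by ring.
    now rewrite sqrt_sqrt.
Qed.

(** For [16 L] forms in [L] variables the rounding error is of order [sqrt L], and the grid
controls the uniform norm. *)
Lemma block_rounding (D : bool -> nat -> R) phi (L : nat) delta (w : nat -> R) :
  (1 <= L)%nat -> 0 < delta ->
  (forall c k, (L < k)%nat -> Rabs (D c k) <= delta) ->
  (forall k, (L < k <= 2 * L)%nat -> 0 <= w k <= 1) ->
  exists b : nat -> bool, forall c x,
    Rabs (lsum (filter b (seq (1 + L) L)) (harmonic (D c) phi x)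
          - lsum (seq (1 + L) L) (fun k => w k * harmonic (D c) phi x k))
      <= 324 * (sqrt (INR L) * delta).
Proof.
  intros HL Hdel HD Hw. set (A := seq (1 + L) L). set (M := (4 * (2 * L))%nat).
  set (rows := grid_rows D phi delta M).
  assert (HL0 : 1 <= INR L) by (apply (le_INR 1); exact HL).
  assert (HlenA : INR (length A) = INR L) by (unfold A; now rewrite length_seq).
  assert (Hlenr : INR (length rows) = 16 * INR L).
  { unfold rows. rewrite length_grid_rows. unfold M. rewrite !mult_INR. simpl. ring. }
  destruct (subset_rounding A rows w) as (b & Hb).
  - apply seq_NoDup.
  - lra.
  - intros v k Hv Hk. apply in_seq in Hk. apply (grid_rows_bound D phi delta M); auto.
    intros c. apply HD. lia.
  - intros k Hk. apply in_seq in Hk. apply Hw. lia.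
  - exists b. intros c x. rewrite HlenA, Hlenr in Hb.
    assert (Hq : root4_mul (16 * INR L) (INR L) <= 2 * sqrt (INR L)) by (apply root4_mul_le_sqrt; nra).
    assert (Heq : forall x, lsum (filter b A) (harmonic (D c) phi x)
        - lsum A (fun k => w k * harmonic (D c) phi x k) =
        lsum A (fun k => (((if b k then 1 else 0) - w k) * D c k) * cos (INR k * x + phi k))).
    { intros y. rewrite lsum_filter, <- lsum_minus. apply lsum_ext. intros k _.
      unfold harmonic. destruct (b k); ring. }
    rewrite Heq.
    replace (324 * (sqrt (INR L) * delta)) with (3 * (108 * (sqrt (INR L) * delta))) by ring.
    apply (grid_sup_bound (2 * L)); [lia| |].
    + intros k Hk. apply in_seq in Hk. lia.
    + intros j Hj. rewrite <- Heq. fold M.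
      assert (H := Hb _ (in_grid_rows D phi delta M c j Hj)). cbv beta in H.
      rewrite lsum_scal in H.
      rewrite (lsum_ext A _ (fun k => / delta * (w k * harmonic (D c) phi (grid_point M j) k))) in H
        by (intros; ring).
      rewrite lsum_scal, <- Rmult_minus_distr_l, Rabs_mult in H.
      rewrite (Rabs_pos_eq (/ delta)) in H by (left; now apply Rinv_0_lt_compat).
      apply Rmult_le_compat_l with (r := delta) in H; [|lra].
      rewrite <- Rmult_assoc, Rinv_r, Rmult_1_l in H by lra.
      eapply Rle_trans; [exact H|].
      replace (108 * (sqrt (INR L) * delta)) with (delta * (54 * (2 * sqrt (INR L)))) by ring.
      apply Rmult_le_compat_l; lra.
Qed.

(** The frequencies spread over [(L, 4L]] because two consecutive sets, one reaching into
[(L, 2L]] and the other into [(2L, 4L]], are compared.  The ordering serves both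
components at once and does not depend on the bound [K] of the total. *)
Lemma block_ordering (D : bool -> nat -> R) phi (L : nat) delta (A : list nat) :
  (1 <= L)%nat -> 0 < delta ->
  (forall c k, (L < k)%nat -> Rabs (D c k) <= delta) ->
  NoDup A -> (forall k, In k A -> (L < k <= 4 * L)%nat) ->
  exists l, Permutation A l /\ forall c K,
    (forall x, Rabs (lsum A (harmonic (D c) phi x)) <= K) ->
    forall n x, Rabs (lsum (firstn n l) (harmonic (D c) phi x)) <=
      3 * K + 22032 * (sqrt (INR L) * delta).
Proof.
  intros HL Hdel HD HA HAL. set (M := (4 * (4 * L))%nat).
  set (rows := grid_rows D phi delta M).
  assert (HL0 : 1 <= INR L) by (apply (le_INR 1); exact HL).
  assert (HlenA : INR (length A) <= 3 * INR L).
  { replace (3 * INR L) with (INR (3 * L)) by (rewrite mult_INR; simpl; ring).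
    apply le_INR. rewrite <- (length_seq (3 * L) (1 + L)). apply NoDup_incl_length; [exact HA|].
    intros k Hk. apply in_seq. specialize (HAL k Hk). lia. }
  assert (Hlenr : INR (length rows) = 32 * INR L).
  { unfold rows. rewrite length_grid_rows. unfold M. rewrite !mult_INR. simpl. ring. }
  destruct (balanced_ordering A rows) as (l & Hp & Hl).
  - exact HA.
  - lra.
  - intros v k Hv Hk. apply (grid_rows_bound D phi delta M); auto.
    intros c. apply HD. specialize (HAL k Hk). lia.
  - exists l. split; [exact Hp|]. intros c K HK n x. rewrite Hlenr in Hl.
    assert (Hq : root4_mul (32 * INR L + 1) (INR (length A)) <= 4 * sqrt (INR L)).
    { pose proof (pos_INR (length A)). apply root4_mul_le_sqrt; nra. }
    replace (3 * K + 22032 * (sqrt (INR L) * delta))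
      with (3 * (K + 7344 * (sqrt (INR L) * delta))) by ring.
    apply (grid_sup_bound (4 * L)); [lia| |].
    + intros k Hk.
      assert (Hin : In k A).
      { apply (Permutation_in k (Permutation_sym Hp)). rewrite <- (firstn_skipn n l).
        apply in_or_app. now left. }
      specialize (HAL k Hin). lia.
    + intros j Hj. fold M.
      assert (H := Hl n _ (in_grid_rows D phi delta M c j Hj)). cbv beta in H.
      rewrite !lsum_scal, !Rabs_mult in H.
      rewrite (Rabs_pos_eq (/ delta)) in H by (left; now apply Rinv_0_lt_compat).
      apply Rmult_le_compat_l with (r := delta) in H; [|lra].
      rewrite Rmult_plus_distr_l, <- !Rmult_assoc, Rinv_r, !Rmult_1_l in H by lra.
      eapply Rle_trans; [exact H|]. apply Rplus_le_compat; [apply HK|].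
      replace (7344 * (sqrt (INR L) * delta)) with (delta * 1836 * (4 * sqrt (INR L))) by ring.
      apply Rmult_le_compat_l; lra.
Qed.

Lemma vallee_poussin_mean D phi L x : (1 <= L)%nat ->
  2 * fejer_mean D phi (L + L) x - fejer_mean D phi L x =
  D 0%nat + lsum (seq 1 L) (harmonic D phi x)
  + lsum (seq (1 + L) L) (fun k => (2 - INR k / INR L) * harmonic D phi x k).
Proof.
  intros HL. assert (HL0 : 0 < INR L) by (apply lt_0_INR; lia).
  unfold fejer_mean. rewrite seq_app, lsum_app, plus_INR.
  rewrite (lsum_ext (seq (1 + L) L) (fun k => (2 - INR k / INR L) * harmonic D phi x k)
    (fun k => 2 * ((1 - INR k / (INR L + INR L)) * (D k * cos (INR k * x + phi k)))))
    by (intros; unfold harmonic; field; lra).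
  rewrite (lsum_ext (seq 1 L) (harmonic D phi x)
    (fun k => 2 * ((1 - INR k / (INR L + INR L)) * (D k * cos (INR k * x + phi k)))
       - (1 - INR k / INR L) * (D k * cos (INR k * x + phi k))))
    by (intros; unfold harmonic; field; lra).
  rewrite lsum_minus, !lsum_scal. ring.
Qed.

(** By monotonicity [L q_L] is at most twice a tail [q_(n0+1) + ... + q_L] of a convergent
series. *)
Lemma monotone_square_decay (q : nat -> R) B eps :
  (forall k, 0 <= q k) -> (forall j k, (1 <= j <= k)%nat -> q k <= q j) ->
  (forall n, lsum (seq 1 n) q <= B) -> 0 < eps ->
  exists L0, forall L, (L0 <= L)%nat -> INR L * q L <= eps.
Proof.
  intros Hq Hmon HB He.
  set (P := fun n => lsum (seq 1 n) q).
  assert (Hstep : forall n, P (S n) = P n + q (S n)).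
  { intros n. unfold P. rewrite seq_S, lsum_app. simpl. ring. }
  destruct (growing_cv P) as [l Hl].
  - intros n. rewrite Hstep. specialize (Hq (S n)). lra.
  - exists B. intros y [n ->]. apply HB.
  - destruct (Hl (eps / 4)) as [n0 Hn0]; [lra|].
    exists (2 * n0 + 1)%nat. intros L HL.
    assert (Hc : P L - P n0 <= eps / 2).
    { assert (H1 := Hn0 L ltac:(lia)). assert (H2 := Hn0 n0 ltac:(lia)).
      unfold R_dist in H1, H2. apply Rabs_def2 in H1. apply Rabs_def2 in H2. lra. }
    assert (Hlow : INR (L - n0) * q L <= P L - P n0).
    { unfold P. replace L with (n0 + (L - n0))%nat at 3 by lia.
      rewrite seq_app, lsum_app.
      rewrite <- (length_seq (L - n0) (1 + n0)) at 1. rewrite <- lsum_const.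
      assert (lsum (seq (1 + n0) (L - n0)) (fun _ => q L) <= lsum (seq (1 + n0) (L - n0)) q);
        [|lra].
      apply lsum_le. intros k Hk. apply in_seq in Hk. apply Hmon. lia. }
    assert (INR L <= 2 * INR (L - n0)).
    { replace (2 * INR (L - n0)) with (INR (2 * (L - n0))) by (rewrite mult_INR; simpl; ring).
      apply le_INR. lia. }
    specialize (Hq L). nra.
Qed.

(** The value at [k] is read off in any list of the chain that is long enough; the lists extend
one another, so the choice is immaterial. *)
Lemma enumeration_of_exhaustion (W o : nat -> list nat) :
  (forall m, W (S m) = W m ++ o m) -> (forall m, NoDup (W m)) ->
  (forall m k, In k (W m) -> (1 <= k)%nat) ->
  (forall k, (1 <= k)%nat -> exists m, In k (W m)) ->
  (forall m, (m <= length (W m))%nat) ->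
  exists sigma, permutation_pos sigma /\
    forall m n, (n <= length (W m))%nat -> map sigma (seq 1 n) = firstn n (W m).
Proof.
  intros HW Hnd Hpos Hall Hlen.
  assert (Hext : forall p m, exists r, W (m + p)%nat = W m ++ r).
  { induction p as [|p IH]; intros m.
    - exists nil. now rewrite Nat.add_0_r, app_nil_r.
    - destruct (IH m) as [r Hr]. exists (r ++ o (m + p)%nat).
      rewrite Nat.add_succ_r, HW, Hr. now rewrite app_assoc. }
  assert (Hnth : forall m m' i, (i < length (W m))%nat -> (i < length (W m'))%nat ->
    nth i (W m) 0%nat = nth i (W m') 0%nat).
  { assert (Hle : forall m m' i, (m <= m')%nat -> (i < length (W m))%nat ->
      nth i (W m') 0%nat = nth i (W m) 0%nat).
    { intros m m' i Hm Hi. destruct (Hext (m' - m)%nat m) as [r Hr].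
      replace (m + (m' - m))%nat with m' in Hr by lia. rewrite Hr. now apply app_nth1. }
    intros m m' i Hi Hi'. destruct (Nat.le_ge_cases m m'); [symmetry|]; now apply Hle. }
  (* Positions in a list start at 0, the permutation at 1; the list of index k
     has at least k entries. *)
  set (sigma := fun k => nth (k - 1) (W k) 0%nat).
  assert (Hs : forall m k, (1 <= k <= length (W m))%nat -> sigma k = nth (k - 1) (W m) 0%nat).
  { intros m k Hk. apply Hnth; [specialize (Hlen k); lia|lia]. }
  exists sigma. split; [split; [|split]|].
  - intros k Hk. apply (Hpos k). apply nth_In. specialize (Hlen k). lia.
  - intros j k Hj Hk He. set (m := Nat.max j k).
    assert (Hm := Hlen m). rewrite (Hs m j), (Hs m k) in He by lia.
    apply (NoDup_nth (W m) 0%nat) in He; [lia|apply Hnd|lia|lia].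
  - intros i Hi. destruct (Hall i Hi) as [m Hm].
    destruct (In_nth _ _ 0%nat Hm) as (p & Hp & He).
    exists (S p). split; [lia|]. rewrite (Hs m) by lia. now replace (S p - 1)%nat with p by lia.
  - intros m n Hn. apply (nth_ext _ _ 0%nat 0%nat).
    + rewrite length_map, length_seq, length_firstn. lia.
    + intros i Hi. rewrite length_map, length_seq in Hi.
      rewrite (nth_indep _ 0%nat (sigma 0%nat)) by (rewrite length_map, length_seq; lia).
      rewrite map_nth, seq_nth by lia. rewrite (Hs m) by lia.
      rewrite nth_firstn. destruct (Nat.ltb_spec i n); [|lia]. f_equal. lia.
Qed.

Lemma locate_block (W o : nat -> list nat) n m0 :
  (forall m, W (S m) = W m ++ o m) -> (forall m, (m <= length (W m))%nat) ->
  (length (W m0) <= n)%nat ->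
  exists m, (m0 <= m)%nat /\ (length (W m) <= n <= length (W (S m)))%nat.
Proof.
  intros HW Hlen Hn.
  assert (Hp : forall p, (n <= length (W (m0 + p)))%nat ->
    exists m, (m0 <= m)%nat /\ (length (W m) <= n <= length (W (S m)))%nat).
  { induction p as [|p IH]; intros Hp.
    - exists m0. rewrite Nat.add_0_r in Hp. split; [lia|]. rewrite HW, length_app. lia.
    - destruct (Nat.le_gt_cases n (length (W (m0 + p)%nat))) as [H|H]; [now apply IH|].
      exists (m0 + p)%nat. rewrite Nat.add_succ_r in Hp. lia. }
  apply (Hp n). specialize (Hlen (m0 + n)%nat). lia.
Qed.

(** * Assembly of the permutation *)

(** The summand [1 / L] keeps the normalizing constant positive when a coefficient vanishes, and
contributes only [1 / sqrt L]. *)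
Lemma block_error_vanishes (mag : nat -> R) eps :
  (forall k, 0 <= mag k) ->
  (forall e, 0 < e -> exists L0, forall L, (L0 <= L)%nat -> INR L * mag L ^ 2 <= e) ->
  0 < eps ->
  exists L0, forall L, (L0 <= L)%nat -> sqrt (INR L) * (mag L + / INR L) <= eps.
Proof.
  intros Hmag Hdec He.
  destruct (Hdec ((eps / 2) ^ 2)) as [L1 HL1]; [nra|].
  destruct (INR_unbounded (/ (eps / 2) ^ 2)) as [L2 HL2].
  exists (S (Nat.max L1 L2)). intros L HL.
  assert (HL0 : 0 < INR L) by (apply lt_0_INR; lia).
  assert (Hs := sqrt_sqrt (INR L) ltac:(lra)). assert (Hs0 := sqrt_lt_R0 _ HL0).
  set (s := sqrt (INR L)) in *.
  assert (H1 : s * mag L <= eps / 2).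
  { specialize (HL1 L ltac:(lia)). rewrite <- Hs in HL1. specialize (Hmag L).
    apply Rnot_lt_le. intros Hc.
    assert ((eps / 2) * (eps / 2) < (s * mag L) * (s * mag L)) by nra. nra. }
  assert (H2 : / s <= eps / 2).
  { apply Rmult_le_reg_l with s; [exact Hs0|]. rewrite Rinv_r by lra.
    assert (H : / (eps / 2) ^ 2 < s * s).
    { rewrite Hs. eapply Rlt_le_trans; [exact HL2|]. apply le_INR. lia. }
    apply Rnot_lt_le. intros Hc.
    assert (Hp : 0 < (eps / 2) ^ 2) by nra.
    apply Rmult_lt_compat_r with (r := (eps / 2) ^ 2) in H; [|exact Hp].
    rewrite Rinv_l in H by lra.
    assert (0 < s * (eps / 2)) by nra. nra. }
  replace (s * (mag L + / INR L)) with (s * mag L + / s).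
  - lra.
  - rewrite <- Hs. field. lra.
Qed.

(** The statement for the two real components, with one permutation for both.  Inside the
block of index [m], a partial sum is the sum over [T_m], which is close to [g], plus a partial
sum of the ordered difference, whose total is a difference of two such sums. *)
Lemma uniform_rearrangement (g : bool -> R -> R) (D : bool -> nat -> R) (phi mag : nat -> R) :
  (forall c, cont (g c)) -> (forall c x, g c (x + 2 * PI) = g c x) ->
  (forall c, fourier_cos_form (g c) (D c) phi) ->
  (forall k, 0 <= mag k) ->
  (forall k, mag k ^ 2 = D true k ^ 2 + D false k ^ 2) ->
  (forall j k, (1 <= j <= k)%nat -> mag k <= mag j) ->
  exists sigma, permutation_pos sigma /\
    forall eps, 0 < eps -> exists n0, forall n, (n0 <= n)%nat -> forall c x,
      Rabs (g c x - D c 0%nat - lsum (map sigma (seq 1 n)) (harmonic (D c) phi x)) <= eps.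
Proof.
  intros Hg Hper HD Hmag Hsq Hmon.
  assert (HDmag : forall c k, Rabs (D c k) <= mag k).
  { intros c k. specialize (Hsq k). specialize (Hmag k).
    apply Rabs_le_between. destruct c; split; nra. }
  set (delta := fun L => mag L + / INR L).
  assert (Hdelta : forall L, (1 <= L)%nat -> 0 < delta L).
  { intros L HL. unfold delta. specialize (Hmag L).
    assert (0 < / INR L) by (apply Rinv_0_lt_compat, lt_0_INR; lia). lra. }
  assert (HDdelta : forall L, (1 <= L)%nat -> forall c k, (L < k)%nat -> Rabs (D c k) <= delta L).
  { intros L HL c k Hk. specialize (Hmon L k ltac:(lia)). specialize (HDmag c k).
    assert (0 < / INR L) by (apply Rinv_0_lt_compat, lt_0_INR; lia). unfold delta. lra. }
  assert (Herr : forall eps, 0 < eps ->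
    exists L0, forall L, (L0 <= L)%nat -> sqrt (INR L) * delta L <= eps).
  { intros eps He. apply block_error_vanishes; auto. intros e He'.
    destruct (coefficients_square_summable _ _ _ (Hg true) (Hper true) (HD true)) as [B1 HB1].
    destruct (coefficients_square_summable _ _ _ (Hg false) (Hper false) (HD false)) as [B2 HB2].
    apply (monotone_square_decay (fun k => mag k ^ 2) (B1 + B2)); auto.
    - intros; apply pow2_ge_0.
    - intros j k Hjk. apply pow_incr. auto.
    - intros n. rewrite (lsum_ext _ _ _ (fun k _ => Hsq k)), lsum_plus.
      specialize (HB1 n). specialize (HB2 n). lra. }
  set (block := fun m => seq (1 + 2 ^ m) (2 ^ m)).
  assert (HL1 : forall m, (1 <= 2 ^ m)%nat) by (intros m; pose proof (Nat.pow_gt_lin_r 2 m Nat.lt_1_2); lia).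
  assert (Hround : forall m, exists b : nat -> bool, forall c x,
    Rabs (lsum (filter b (block m)) (harmonic (D c) phi x)
      - lsum (block m) (fun k => (2 - INR k / INR (2 ^ m)) * harmonic (D c) phi x k))
    <= 324 * (sqrt (INR (2 ^ m)) * delta (2 ^ m)%nat)).
  { intros m. apply block_rounding; auto. intros k Hk.
    assert (Hp : 0 < INR (2 ^ m)) by (apply lt_0_INR; auto).
    assert (H1 : INR (2 ^ m) <= INR k) by (apply le_INR; lia).
    assert (H2 : INR k <= 2 * INR (2 ^ m)).
    { replace (2 * INR (2 ^ m)) with (INR (2 * 2 ^ m)) by (rewrite mult_INR; simpl; ring).
      apply le_INR. lia. }
    assert (INR k / INR (2 ^ m) * INR (2 ^ m) = INR k) by (field; lra).
    split; nra. }
  set (b := fun m => proj1_sig (constructive_indefinite_description _ (Hround m))).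
  assert (Hb : forall m c x,
    Rabs (lsum (filter (b m) (block m)) (harmonic (D c) phi x)
      - lsum (block m) (fun k => (2 - INR k / INR (2 ^ m)) * harmonic (D c) phi x k))
    <= 324 * (sqrt (INR (2 ^ m)) * delta (2 ^ m)%nat)).
  { intros m. exact (proj2_sig (constructive_indefinite_description _ (Hround m))). }
  clearbody b. clear Hround.
  set (T := fun m => seq 1 (2 ^ m) ++ filter (b m) (block m)).
  set (gap := fun m => filter (fun k => negb (b m k)) (block m) ++ filter (b (S m)) (block (S m))).
  assert (Hseq : forall m, seq 1 (2 ^ S m) = seq 1 (2 ^ m) ++ block m).
  { intros m. unfold block. rewrite <- seq_app. f_equal. simpl. lia. }
  assert (HT : forall m, Permutation (T m ++ gap m) (T (S m))).
  { intros m. unfold T, gap. rewrite Hseq, <- !app_assoc. apply Permutation_app_head.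
    rewrite !app_assoc. apply Permutation_app_tail. symmetry. apply permutation_filter_split. }
  assert (Hblock : forall m k, In k (block m) <-> (2 ^ m < k <= 2 * 2 ^ m)%nat).
  { intros m k. unfold block. rewrite in_seq. lia. }
  assert (HTnd : forall m, NoDup (T m)).
  { intros m. apply NoDup_app.
    - apply seq_NoDup.
    - apply NoDup_filter, seq_NoDup.
    - intros k Hk Hk'. apply in_seq in Hk. apply filter_In in Hk'. rewrite Hblock in Hk'. lia. }
  assert (Hgapnd : forall m, NoDup (gap m)).
  { intros m. assert (H := HTnd (S m)). apply (Permutation_NoDup (Permutation_sym (HT m))) in H.
    now apply NoDup_app_remove_l in H. }
  assert (Hgap : forall m k, In k (gap m) -> (2 ^ m < k <= 4 * 2 ^ m)%nat).
  { intros m k Hk. unfold gap in Hk. apply in_app_or in Hk.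
    destruct Hk as [Hk|Hk]; apply filter_In in Hk; rewrite Hblock in Hk; simpl in Hk; lia. }
  assert (Hord : forall m, exists l, Permutation (gap m) l /\ forall c K,
    (forall x, Rabs (lsum (gap m) (harmonic (D c) phi x)) <= K) ->
    forall n x, Rabs (lsum (firstn n l) (harmonic (D c) phi x)) <=
      3 * K + 22032 * (sqrt (INR (2 ^ m)) * delta (2 ^ m)%nat)).
  { intros m. apply block_ordering; auto. }
  set (ord := fun m => proj1_sig (constructive_indefinite_description _ (Hord m))).
  assert (Ho : forall m, Permutation (gap m) (ord m) /\ forall c K,
    (forall x, Rabs (lsum (gap m) (harmonic (D c) phi x)) <= K) ->
    forall n x, Rabs (lsum (firstn n (ord m)) (harmonic (D c) phi x)) <=
      3 * K + 22032 * (sqrt (INR (2 ^ m)) * delta (2 ^ m)%nat)).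
  { intros m. exact (proj2_sig (constructive_indefinite_description _ (Hord m))). }
  clearbody ord. clear Hord.
  set (W := fix W m := match m with O => T 0%nat | S m' => W m' ++ ord m' end).
  assert (HWT : forall m, Permutation (W m) (T m)).
  { induction m as [|m IH]; [reflexivity|]. simpl W. rewrite <- (HT m).
    apply Permutation_app; [exact IH|]. symmetry. apply Ho. }
  assert (HWlen : forall m, (m <= length (W m))%nat).
  { intros m. rewrite (Permutation_length (HWT m)). unfold T.
    rewrite length_app, length_seq. pose proof (Nat.pow_gt_lin_r 2 m Nat.lt_1_2). lia. }
  destruct (enumeration_of_exhaustion W ord) as (sigma & Hsig & Hsum).
  - reflexivity.
  - intros m. apply (Permutation_NoDup (Permutation_sym (HWT m))), HTnd.
  - intros m k Hk. apply (Permutation_in k (HWT m)) in Hk. apply in_app_or in Hk.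
    destruct Hk as [Hk|Hk]; [apply in_seq in Hk; lia|].
    apply filter_In in Hk. rewrite Hblock in Hk. lia.
  - intros k Hk. exists k. apply (Permutation_in k (Permutation_sym (HWT k))).
    apply in_or_app. left. apply in_seq. pose proof (Nat.pow_gt_lin_r 2 k Nat.lt_1_2). lia.
  - exact HWlen.
  - exists sigma. split; [exact Hsig|]. intros eps He.
    (* With every elementary error at most e, the partial sums are within
       327 e + 3 * (2 * 327 e) + 22032 e = 24321 e of the function. *)
    set (e := eps / 25000).
    assert (He0 : 0 < e) by (unfold e; lra).
    assert (Hf : exists N0, forall N, (N0 <= N)%nat -> forall c x,
      Rabs (fejer_mean (D c) phi N x - g c x) <= e).
    { destruct (fejer_uniform _ _ _ e (Hg true) (Hper true) (HD true) He0) as [N1 HN1].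
      destruct (fejer_uniform _ _ _ e (Hg false) (Hper false) (HD false) He0) as [N2 HN2].
      exists (Nat.max N1 N2). intros N HN [|] x; [apply HN1|apply HN2]; lia. }
    destruct Hf as [N0 HN0]. destruct (Herr e He0) as [L0 HL0].
    set (m0 := Nat.max N0 L0).
    assert (Hsmall : forall m, (m0 <= m)%nat -> sqrt (INR (2 ^ m)) * delta (2 ^ m)%nat <= e).
    { intros m Hm. apply HL0. pose proof (Nat.pow_gt_lin_r 2 m Nat.lt_1_2). lia. }
    assert (HTclose : forall m, (m0 <= m)%nat -> forall c x,
      Rabs (g c x - D c 0%nat - lsum (T m) (harmonic (D c) phi x)) <= 327 * e).
    { intros m Hm c x. specialize (Hsmall m Hm). assert (Hbm := Hb m c x).
      assert (Hv := vallee_poussin_mean (D c) phi (2 ^ m) x (HL1 m)).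
      assert (H1 := HN0 (2 ^ m)%nat ltac:(pose proof (Nat.pow_gt_lin_r 2 m Nat.lt_1_2); lia) c x).
      assert (H2 := HN0 (2 ^ m + 2 ^ m)%nat ltac:(pose proof (Nat.pow_gt_lin_r 2 m Nat.lt_1_2); lia) c x).
      unfold T. rewrite lsum_app. fold (block m) in Hv.
      apply Rabs_le_between in Hbm. apply Rabs_le_between in H1. apply Rabs_le_between in H2.
      apply Rabs_le_between. lra. }
    exists (length (W m0)). intros n Hn c x.
    destruct (locate_block W ord n m0) as (m & Hm & Hnm); auto.
    rewrite (Hsum (S m) n) by apply Hnm. simpl W.
    rewrite firstn_app, firstn_all2 by lia.
    rewrite lsum_app, (lsum_perm _ _ _ (HWT m)).
    assert (Hgapsmall : forall y, Rabs (lsum (gap m) (harmonic (D c) phi y)) <= 654 * e).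
    { intros y. assert (H1 := HTclose m Hm c y). assert (H2 := HTclose (S m) ltac:(lia) c y).
      rewrite <- (lsum_perm _ _ _ (HT m)), lsum_app in H2.
      apply Rabs_le_between in H1. apply Rabs_le_between in H2. apply Rabs_le_between. lra. }
    assert (Hpre := proj2 (Ho m) c _ Hgapsmall (n - length (W m))%nat x).
    assert (H1 := HTclose m Hm c x). specialize (Hsmall m Hm).
    apply Rabs_le_between in H1. apply Rabs_le_between in Hpre.
    apply Rabs_le_between. unfold e in *. lra.
Qed.

Lemma sum_n_m_components (h : nat -> C) n :
  sum_n_m (G := C_AbelianMonoid) h 1 n =
  (lsum (seq 1 n) (fun k => fst (h k)), lsum (seq 1 n) (fun k => snd (h k))).
Proof.
  induction n as [|n IH].
  - rewrite sum_n_m_zero by lia. reflexivity.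
  - rewrite sum_n_Sm, IH by lia. rewrite seq_S, !lsum_app. cbn [lsum Nat.add].
    rewrite !Rplus_0_r. reflexivity.
Qed.

Lemma unif_norm_le (h : R -> C) eps :
  (forall x, Cmod (h x) <= eps) -> 0 <= unif_norm h <= eps.
Proof.
  intros H. unfold unif_norm.
  set (E := fun y : R => exists x : R, y = Cmod (h x)).
  assert (Hlub := Lub_Rbar_correct E). destruct Hlub as [Hub Hleast].
  assert (H1 : Rbar_le (Lub_Rbar E) eps) by (apply Hleast; intros y [x ->]; apply H).
  assert (H2 : Rbar_le (Cmod (h 0)) (Lub_Rbar E)) by (apply Hub; now exists 0).
  pose proof (Cmod_ge_0 (h 0)).
  destruct (Lub_Rbar E) as [r| |]; simpl in *; [lra|easy|easy].
Qed.

Lemma Cmod_le_components (z : C) eps :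
  Rabs (fst z) <= eps -> Rabs (snd z) <= eps -> Cmod z <= 2 * eps.
Proof.
  intros H1 H2. unfold Cmod. pose proof (Rabs_pos (fst z)).
  rewrite <- (sqrt_Rsqr (2 * eps)) by lra. apply sqrt_le_1_alt.
  apply Rabs_le_between in H1. apply Rabs_le_between in H2. unfold Rsqr. nra.
Qed.

Theorem mainTheorem3 (f : R -> C) (d : nat -> C) (phi : nat -> R)
  (hf : continuous_on_circle f)
  (hA0 : forall x : R, fourier_term f 0 x = d 0%nat)
  (hA : forall (k : nat) (x : R), (1 <= k)%nat ->
     fourier_term f k x = (d k * RtoC (cos (INR k * x + phi k)))%C)
  (hd : forall k : nat, (1 <= k)%nat -> Cmod (d (S k)) <= Cmod (d k)) :
  exists sigma : nat -> nat,
    permutation_pos sigma /\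
    is_lim_seq
      (fun n : nat =>
         unif_norm (fun x : R =>
           (f x - d 0%nat -
            sum_n_m (fun k : nat => fourier_term f (sigma k) x) 1 n)%C))
      0.
Proof.
  destruct hf as [Hcont Hper].
  set (part := fun (c : bool) (z : C) => if c then fst z else snd z).
  assert (C1 : cont (fun t => fst (f t)))
    by (intros t; apply (continuous_comp f fst); [apply Hcont|apply continuous_fst]).
  assert (C2 : cont (fun t => snd (f t)))
    by (intros t; apply (continuous_comp f snd); [apply Hcont|apply continuous_snd]).
  assert (Hterm : forall k x, (1 <= k)%nat -> fourier_term f k x =
    (harmonic (fun j => fst (d j)) phi x k, harmonic (fun j => snd (d j)) phi x k)).
  { intros k x Hk. rewrite hA by exact Hk. unfold harmonic, Cmult, RtoC. simpl. f_equal; ring. }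
  assert (H0 : d 0%nat = (/ (2 * PI) * circle_int (fun t => fst (f t)),
                          / (2 * PI) * circle_int (fun t => snd (f t)))).
  { rewrite <- (hA0 0). unfold fourier_term. rewrite fourier_coeff_components by assumption.
    f_equal; f_equal.
    - rewrite (circle_int_ext (fun t => snd (f t) * _) (fun _ => 0)), circle_int_const.
      + rewrite Rmult_0_r, Rplus_0_r. apply circle_int_ext. intros t.
        rewrite Rmult_0_l, cos_0. ring.
      + intros t. rewrite Rmult_0_l, sin_0. ring.
    - rewrite (circle_int_ext (fun t => fst (f t) * _) (fun _ => 0)), circle_int_const.
      + rewrite Rmult_0_r, Rminus_0_r. apply circle_int_ext. intros t.
        rewrite Rmult_0_l, cos_0. ring.
      + intros t. rewrite Rmult_0_l, sin_0. ring. }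
  destruct (uniform_rearrangement (fun c x => part c (f x)) (fun c k => part c (d k)) phi
    (fun k => Cmod (d k))) as (sigma & Hsig & Hconv).
  - intros [|]; assumption.
  - intros c x. now rewrite Hper.
  - intros c. split.
    + unfold part. rewrite H0. now destruct c.
    + intros k x Hk. assert (H := Hterm k x Hk).
      rewrite fourier_term_components in H by assumption.
      unfold part. destruct c; symmetry; [exact (f_equal fst H)|exact (f_equal snd H)].
  - intros k. apply Cmod_ge_0.
  - intros k. unfold Cmod, part. rewrite pow2_sqrt; [reflexivity|].
    pose proof (pow2_ge_0 (fst (d k))). pose proof (pow2_ge_0 (snd (d k))). lra.
  - intros j k [Hj Hjk]. induction Hjk as [|k Hjk IH]; [lra|].
    eapply Rle_trans; [apply hd; lia|exact IH].
  - exists sigma. split; [exact Hsig|].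
    apply is_lim_seq_spec. intros eps.
    destruct (Hconv (eps / 4)) as [n0 Hn0]; [pose proof (cond_pos eps); lra|].
    exists n0. intros n Hn. rewrite Rminus_0_r.
    match goal with |- Rabs (unif_norm ?h) < _ =>
      assert (Hle : 0 <= unif_norm h <= 2 * (eps / 4)) end.
    { apply unif_norm_le. intros x. apply Cmod_le_components.
      - specialize (Hn0 n Hn true x). rewrite lsum_map in Hn0.
        rewrite sum_n_m_components. unfold Cminus, Cplus, Copp; simpl.
        rewrite (lsum_ext _ _ (fun k => harmonic (fun j => fst (d j)) phi x (sigma k))).
        + exact Hn0.
        + intros k Hk. apply in_seq in Hk. rewrite Hterm; [reflexivity|]. apply Hsig. lia.
      - specialize (Hn0 n Hn false x). rewrite lsum_map in Hn0.
        rewrite sum_n_m_components. unfold Cminus, Cplus, Copp; simpl.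
        rewrite (lsum_ext _ _ (fun k => harmonic (fun j => snd (d j)) phi x (sigma k))).
        + exact Hn0.
        + intros k Hk. apply in_seq in Hk. rewrite Hterm; [reflexivity|]. apply Hsig. lia. }
    rewrite Rabs_pos_eq by lra. pose proof (cond_pos eps). lra.
Qed.
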